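(* Let $\mathbf{k}$ be an algebraically closed field, $R=\mathbf{k}[\![x_1,\dots,x_n]\!]$, and let $A=R/I$ be a local Artin ring with $\mathrm{gcl}(A)>1$. With $MGC_2(A)$, the ideals $\mathfrak a,\mathfrak b,\mathfrak c$ and the projection $\pi_1:\mathbb{P}_{\mathbf{k}}^{h_1+h_2-1}\times\mathbb{P}_{\mathbf{k}}^{n-1}\to\mathbb{P}_{\mathbf{k}}^{h_1+h_2-1}$ defined in the context, $$MGC_2(A)=\mathbb{V}_+(\mathfrak b)\setminus\pi_1\big(\mathbb{V}_+(\mathfrak c)\cap\mathbb{V}_+(\mathfrak a)\big).$$
   Context: $\mathfrak m$ is the maximal ideal of $R$ and $S=\mathbf{k}[y_1,\dots,y_n]$ is an $R$-module by contraction: $x^\alpha\circ y^\beta=y^{\beta-\alpha}$ if $\beta\ge\alpha$ componentwise and $0$ otherwise. $I^\perp=\{G\in S: I\circ G=0\}$, $\langle F\rangle=R\circ F$, $\mathrm{Ann}_R F=\{f\in R: f\circ F=0\}$, and $\int_K M=\{G\in S: K\circ G\subset M\}$. $\ell$ denotes length. $G=R/\mathrm{Ann}_RF$ is a Gorenstein cover of $A=R/I$ if $I^\perp\subset\langle F\rangle$; $\mathrm{gcl}(A)=\min\{\ell(G)-\ell(A)\}$ over all Gorenstein covers. Let $s$ be the socle degree of $A$ (largest $i$ with $\mathfrak m^i\not\subset I$). Fix polynomials such that $b_1,\dots,b_t$ is a $\mathbf{k}$-basis of $I^\perp$; $b_1,\dots,b_t,F_1,\dots,F_{h_1}$ is a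 $\mathbf{k}$-basis of $\int_{\mathfrak m}I^\perp$; and $b_1,\dots,b_t,F_1,\dots,F_{h_1},G_1,\dots,G_{h_2}$ is a $\mathbf{k}$-basis of $\int_{\mathfrak m^2}I^\perp$. Put $H=\sum_{i=1}^{h_1}\alpha_iF_i+\sum_{i=1}^{h_2}\beta_iG_i$; points of $\mathbb{P}_{\mathbf{k}}^{h_1+h_2-1}$ are written $[H]=(\alpha_1:\dots:\alpha_{h_1}:\beta_1:\dots:\beta_{h_2})$, and points of $\mathbb{P}_{\mathbf{k}}^{n-1}$ are written $[v]=(v_1:\dots:v_n)$. $MGC_2(A)$ is the set of $[H]\in\mathbb{P}_{\mathbf{k}}^{h_1+h_2-1}$ such that $G=R/\mathrm{Ann}_RH$ is a Gorenstein cover of $A$ with $\ell(G)-\ell(A)=2$. For $1\le k\le n$ write $x_k\circ H=\sum_{j=1}^t\mu_k^jb_j+\sum_{j=1}^{h_1}\rho_k^jF_j$ (the $\rho_k^j$ are linear forms in $\beta_1,\dots,\beta_{h_2}$). $B_H=(\rho_k^j)_{1\le k\le n,1\le j\le h_1}$, and $C_{H,v}$ is the $n\times(h_1+1)$ matrix obtained from $B_H$ by appending the column $(v_1,\dots,v_n)^T$. $\mathfrak b$ is the ideal generated by the $2\times2$ minors of $B_H$ and $\mathbb{V}_+(\mathfrak b)\subset\mathbb{P}_{\mathbf{k}}^{h_1+h_2-1}$ its zero set; $\mathfrak c\subset\mathbf{k}[\alpha,\beta,v]$ is the bihomogeneous ideal generated by the $2\times2$ minors of $C_{H,v}$ and $\mathbb{V}_+(\mathfrak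 c)\subset\mathbb{P}_{\mathbf{k}}^{h_1+h_2-1}\times\mathbb{P}_{\mathbf{k}}^{n-1}$ its zero set. $U_{H,v}$ is the matrix with $t$ columns whose rows are: for $1\le l<k\le n$, the row $(v_l\mu_k^j-v_k\mu_l^j)_{1\le j\le t}$ of $b_j$-coefficients of $(v_lx_k-v_kx_l)\circ H$; and for $\theta\in\mathbb{N}^n$ with $2\le|\theta|\le s+2$, the row of coefficients of $x^\theta\circ H\in I^\perp$ in the basis $b_1,\dots,b_t$. $\mathfrak a\subset\mathbf{k}[\alpha,\beta,v]$ is the bihomogeneous ideal generated by the $t\times t$ minors of $U_{H,v}$, and $\mathbb{V}_+(\mathfrak a)=\{([H],[v]):\mathrm{rk}\,U_{H,v}<t\}\subset\mathbb{P}_{\mathbf{k}}^{h_1+h_2-1}\times\mathbb{P}_{\mathbf{k}}^{n-1}$. *)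

(* Defs.v *)
From HB Require Import structures.
From mathcomp Require Import all_boot all_order all_algebra.
From mathcomp Require Import boolp classical_sets.
From mathcomp Require Import mpoly.

Set Implicit Arguments.
Unset Strict Implicit.
Unset Printing Implicit Defensive.

Import GRing.Theory.

Local Open Scope ring_scope.
Local Open Scope classical_set_scope.


Record mpseries (n : nat) (R : Type) :=
  MPSeries { pscoef :> 'X_{1..n} -> R }.
Arguments MPSeries {n R} _.

HB.instance Definition _ (n : nat) (R : Type) := gen_eqMixin (mpseries n R).
HB.instance Definition _ (n : nat) (R : Type) := gen_choiceMixin (mpseries n R).

Section PowerSeriesRing.
Context {n : nat} {R : comNzRingType}.
Implicit Types f g h : mpseries n R.

Lemma mpseriesP f g : (forall m, f m = g m) -> f = g.
Proof. by case: f g => [f] [g] /= /funext ->. Qed.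

Definition ps0 : mpseries n R := MPSeries (fun=> 0).
Definition psopp f : mpseries n R := MPSeries (fun m => - f m).
Definition psadd f g : mpseries n R := MPSeries (fun m => f m + g m).

Fact psaddA : associative psadd.
Proof. by move=> f g h; apply: mpseriesP => m /=; rewrite addrA. Qed.
Fact psaddC : commutative psadd.
Proof. by move=> f g; apply: mpseriesP => m /=; rewrite addrC. Qed.
Fact psadd0 : left_id ps0 psadd.
Proof. by move=> f; apply: mpseriesP => m /=; rewrite add0r. Qed.
Fact psaddN : left_inverse ps0 psopp psadd.
Proof. by move=> f; apply: mpseriesP => m /=; rewrite addNr. Qed.

HB.instance Definition _ :=
  GRing.isZmodule.Build (mpseries n R) psaddA psaddC psadd0 psaddN.

Definition psmon (theta : 'X_{1..n}) : mpseries n R :=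
  MPSeries (fun m => (m == theta)%:R).

Definition psmul f g : mpseries n R :=
  MPSeries (fun m =>
    \sum_(k : 'X_{1..n < (mdeg m).+1, (mdeg m).+1} | m == (k.1 + k.2)%MM)
      f k.1 * g k.2).

Let trunc d f : {mpoly R[n]} := \sum_(m : 'X_{1..n < d}) (f m *: 'X_[m]).

Let truncE d f m : (mdeg m < d)%N -> (trunc d f)@_m = f m.
Proof. exact: mcoeff_mpoly. Qed.

Let psmulE d f g m : (mdeg m < d)%N ->
  psmul f g m = (trunc d f * trunc d g)@_m.
Proof.
move=> lt_md; rewrite mcoeffM; apply: eq_bigr => k _.
by rewrite !truncE // (leq_trans (bmdeg _)).
Qed.

Let eq_mcoeffM d (p p' q q' : {mpoly R[n]}) m : (mdeg m < d)%N ->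
  (forall a, (mdeg a < d)%N -> p@_a = p'@_a) ->
  (forall a, (mdeg a < d)%N -> q@_a = q'@_a) ->
  (p * q)@_m = (p' * q')@_m.
Proof.
move=> lt_md eqp eqq; rewrite !mcoeffM; apply: eq_bigr => k _.
by rewrite eqp ?eqq // (leq_trans (bmdeg _)).
Qed.

Fact psmulC : commutative psmul.
Proof.
by move=> f g; apply: mpseriesP => m; rewrite !(psmulE _ _ (ltnSn _)) mulrC.
Qed.

Fact psmulA : associative psmul.
Proof.
move=> f g h; apply: mpseriesP => m; set d := (mdeg m).+1.
have lt_md : (mdeg m < d)%N by [].
rewrite !(psmulE _ _ lt_md).
rewrite (eq_mcoeffM (p' := trunc d f) (q' := trunc d g * trunc d h) lt_md) //.
  rewrite mulrA; apply: (eq_mcoeffM lt_md) => // a lt_ad.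
  by rewrite truncE // -psmulE.
by move=> a lt_ad; rewrite truncE // -psmulE.
Qed.

Fact psmul1 : left_id (psmon 0%MM) psmul.
Proof.
move=> f; apply: mpseriesP => m; set d := (mdeg m).+1.
have lt_md : (mdeg m < d)%N by [].
rewrite (psmulE _ _ lt_md) -[RHS](truncE f lt_md) -[trunc d f in RHS]mul1r.
apply: (eq_mcoeffM lt_md) => // a lt_ad.
by rewrite truncE //= mcoeff1.
Qed.

Fact psmulDl : left_distributive psmul +%R.
Proof.
move=> f g h; apply: mpseriesP => m /=; rewrite -big_split /=.
by apply: eq_bigr => k _; rewrite mulrDl.
Qed.

Fact ps1_neq0 : psmon 0%MM != 0.
Proof.
apply/eqP => /(congr1 (fun f : mpseries n R => f 0%MM)) /= /eqP.
by rewrite eqxx oner_eq0.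
Qed.

HB.instance Definition _ :=
  GRing.Zmodule_isComNzRing.Build (mpseries n R)
    psmulA psmulC psmul1 psmulDl ps1_neq0.

End PowerSeriesRing.


Section Ideals.
Context {R : comNzRingType}.
Implicit Types (I J K M : set R).

Definition is_ideal J : Prop :=
  [/\ J 0, forall x y, J x -> J y -> J (x + y) &
      forall a x, J x -> J (a * x)].

Definition ideal_gen (X : set R) : set R := smallest is_ideal X.

Definition ideal_mul J K : set R :=
  ideal_gen [set z | exists x y, [/\ J x, K y & z = x * y]].

Definition ideal_exp J (i : nat) : set R := iter i (ideal_mul J) [set: R].

Definition maximal_ideal M : Prop :=
  [/\ is_ideal M, M <> [set: R] &
      forall J, is_ideal J -> M `<=` J -> J = M \/ J = [set: R]].

(* Ideals and R-submodules of R / I are given by the ideals of R containing I;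
   the next three notions are those of R / I being local, R / I being Artinian
   and R / I having length l as an R-module. *)

Definition local_quotient I : Prop :=
  exists! M, maximal_ideal M /\ I `<=` M.

Definition artinian_quotient I : Prop :=
  forall c : nat -> set R,
    (forall i, is_ideal (c i) /\ I `<=` c i) ->
    (forall i, c i.+1 `<=` c i) ->
    exists N, forall i, (N <= i)%N -> c i = c N.

Definition ideal_chain I (l : nat) : Prop :=
  exists c : nat -> set R,
    [/\ c 0%N = I, c l = [set: R], forall i, (i <= l)%N -> is_ideal (c i) &
        forall i, (i < l)%N -> c i `<` c i.+1].

Definition quotient_length I (l : nat) : Prop :=
  ideal_chain I l /\ forall l', ideal_chain I l' -> (l' <= l)%N.

End Ideals.


Section InverseSystem.
Context {n : nat} {k : fieldType}.
Local Notation R := (mpseries n k).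
Local Notation S := {mpoly k[n]}.
Implicit Types (I K : set R) (M : set S) (f : R) (F G : S).

(* f o F = sum_(alpha <= beta) f_alpha F_beta y^(beta - alpha) *)
Definition contract f F : S :=
  \sum_(beta <- msupp F)
    \sum_(alpha : 'X_{1..n < (mdeg beta).+1} | (alpha <= beta)%MM)
      (f alpha * F@_beta) *: 'X_[(beta - alpha)%MM].

Definition psX (i : 'I_n) : R := psmon U_(i)%MM.

Definition frak_m : set R := [set f | f 0%MM = 0].

Definition perp I : set S := [set G | forall f, I f -> contract f G = 0].

Definition cyc F : set S := [set G | exists f, G = contract f F].

Definition Ann F : set R := [set f | contract f F = 0].

Definition integral K M : set S :=
  [set G | forall f, K f -> M (contract f G)].

Definition socle_degree I (s : nat) : Prop :=
  ~ (ideal_exp frak_m s `<=` I) /\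
  forall i, ~ (ideal_exp frak_m i `<=` I) -> (i <= s)%N.

(* R / Ann F is a Gorenstein cover of R / I. *)
Definition gorenstein_cover I F : Prop := perp I `<=` cyc F.

(* R / Ann F is a Gorenstein cover G of A = R / I with l(G) - l(A) = d. *)
Definition gorenstein_cover_colength I F (d : nat) : Prop :=
  gorenstein_cover I F /\
  exists lG lA, [/\ quotient_length (Ann F) lG, quotient_length I lA &
                    lG = (lA + d)%N].

Definition gcl I (d : nat) : Prop :=
  (exists F, gorenstein_cover_colength I F d) /\
  forall F d', gorenstein_cover_colength I F d' -> (d <= d')%N.


Definition is_kbasis m (X : 'I_m -> S) M : Prop :=
  [/\ forall i, M (X i),
      forall c : 'I_m -> k, \sum_i c i *: X i = 0 -> forall i, c i = 0 &
      forall G, M G -> exists c : 'I_m -> k, G = \sum_i c i *: X i].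

Definition catf p q (X : 'I_p -> S) (Y : 'I_q -> S) (i : 'I_(p + q)) : S :=
  match split i with inl j => X j | inr j => Y j end.

(* The coordinates of G on the free family X; 0 if G is not in its span. *)
Definition coords m (X : 'I_m -> S) G : 'rV[k]_m :=
  xget 0 [set c : 'rV[k]_m | G = \sum_i c 0 i *: X i].

End InverseSystem.


Section Projective.
Context {k : fieldType}.

(* Points of the projective space P^(m-1) are the lines of k^m. *)
Definition proj (m : nat) := {L : {vspace 'rV[k]_m} | \dim L == 1%N}.

Definition homog_coords m (P : proj m) (u : 'rV[k]_m) : Prop :=
  u != 0 /\ u \in val P.

Definition Vplus m (J : set {mpoly k[m]}) : set (proj m) :=
  [set P | forall u, homog_coords P u ->
           forall f, J f -> f.@[fun i => u 0 i] = 0].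

Definition Vplus2 m p (J : set {mpoly k[m + p]}) : set (proj m * proj p) :=
  [set PQ | forall u v, homog_coords PQ.1 u -> homog_coords PQ.2 v ->
            forall f, J f -> f.@[fun i => row_mx u v 0 i] = 0].

End Projective.
Arguments proj : clear implicits.

Definition minors (A : comNzRingType) p q (r : nat) (M : 'M[A]_(p, q)) : set A :=
  [set d | exists (f : 'I_r -> 'I_p) (g : 'I_r -> 'I_q),
    [/\ {homo f : i j / (i < j)%N}, {homo g : i j / (i < j)%N} &
        d = \det (mxsub f g M)]].


Section MGC2.
Context {k : fieldType} {n : nat}.
Local Notation R := (mpseries n k).
Local Notation S := {mpoly k[n]}.
Variables (I : set R) (s t h1 h2 : nat).
Variables (b : 'I_t -> S) (F : 'I_h1 -> S) (G : 'I_h2 -> S).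

(* H = sum_i alpha_i F_i + sum_i beta_i G_i for u = (alpha, beta) *)
Definition Hof (u : 'rV[k]_(h1 + h2)) : S :=
  \sum_i u 0 i *: catf F G i.

Definition MGC2 : set (proj k (h1 + h2)) :=
  [set P | exists2 u, homog_coords P u &
                      gorenstein_cover_colength I (Hof u) 2].

Section GenericMatrices.
Variable N : nat.

(* The matrices below have entries in a polynomial ring k[z_1, ..., z_N];
   w i is the variable standing for the i-th coordinate of (alpha, beta) and
   v l the one standing for v_l. As x^theta o H is linear in (alpha, beta), its
   coordinates on a basis are the linear forms
     sum_i w_i * (coordinates of x^theta o (F, G)_i). *)
Variables (w : 'I_(h1 + h2) -> {mpoly k[N]}) (v : 'I_n -> {mpoly k[N]}).

Definition generic_coords m (X : 'I_m -> S) (f : R) :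
    'rV[{mpoly k[N]}]_m :=
  \row_j \sum_i coords X (contract f (catf F G i)) 0 j *: w i.

Definition mu_mx : 'M[{mpoly k[N]}]_(n, t) :=
  \matrix_(i < n) lsubmx (generic_coords (catf b F) (psX i)).

Definition B_mx : 'M[{mpoly k[N]}]_(n, h1) :=
  \matrix_(i < n) rsubmx (generic_coords (catf b F) (psX i)).

Definition C_mx : 'M[{mpoly k[N]}]_(n, h1 + 1) :=
  row_mx B_mx (\col_(i < n) v i).

Definition U_rows : seq 'rV[{mpoly k[N]}]_t :=
  [seq \row_j (v lk.1 * mu_mx lk.2 j - v lk.2 * mu_mx lk.1 j)
     | lk <- enum [pred lk : 'I_n * 'I_n | (lk.1 < lk.2)%N]] ++
  [seq generic_coords b (psmon (bmnm theta))
     | theta <- enum [pred theta : 'X_{1..n < s.+3} | (2 <= mdeg theta)%N]].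

Definition U_mx : 'M[{mpoly k[N]}]_(size U_rows, t) :=
  \matrix_(i < size U_rows) nth 0 U_rows i.

End GenericMatrices.

Definition frak_b : set {mpoly k[h1 + h2]} :=
  ideal_gen (minors 2 (B_mx (fun i => 'X_i))).

(* In k[alpha, beta, v] the variables are ordered as (alpha, beta, v). *)
Definition frak_c : set {mpoly k[(h1 + h2) + n]} :=
  ideal_gen (minors 2 (C_mx (fun i => 'X_(lshift n i))
                            (fun l => 'X_(rshift (h1 + h2) l)))).

Definition frak_a : set {mpoly k[(h1 + h2) + n]} :=
  ideal_gen (minors t (U_mx (fun i => 'X_(lshift n i))
                            (fun l => 'X_(rshift (h1 + h2) l)))).

End MGC2.

(* Main.v *)
Require Import Defs.
From HB Require Import structures.
From mathcomp Require Import all_boot all_order all_algebra.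
From mathcomp Require Import boolp classical_sets.
From mathcomp Require Import mpoly.

Set Implicit Arguments.
Unset Strict Implicit.
Unset Printing Implicit Defensive.

Import GRing.Theory.

Local Open Scope ring_scope.
Local Open Scope classical_set_scope.

(* The length of [R/J], for an ideal [J] containing a power of the maximal
   ideal, is its dimension over [k]; hence [R/Ann H] has length [dim <H>] and,
   by Macaulay duality, [R/I] has length [t]. If [H] is not in [I^perp] and
   [I^perp] is contained in [<H>], then [<H>] is spanned by [I^perp], [H] and the
   [x_i o H], so it has dimension [t + rk B_H + 1]: the colength is [rk B_H + 1],
   and [gcl > 1] forces [rk B_H >= 1]. Thus [H] is in [MGC_2] iff it is a cover
   and [rk B_H <= 1]. If [rk C_{H,v} <= 1], then the forms [v_l x_i - v_i x_l]
   send [H] into [I^perp], so the rows of [U_{H,v}] are coordinates of elements of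
   [<H>], and [H] is a cover as soon as they span. Conversely, if [H] is a cover
   and [rk B_H = 1], then [v] spans the column space of [B_H], every linear form
   sending [H] into [I^perp] is a combination of the [v_l x_i - v_i x_l], and the
   rows of [U_{H,v}] span because [I^perp] is contained in [m o H]. *)

(** * Contraction of polynomials by power series *)

Section Contraction.
Context {n : nat} {k : fieldType}.
Local Notation R := (mpseries n k).
Local Notation S := {mpoly k[n]}.
Implicit Types (f g : R) (F G : S) (m : 'X_{1..n}).

Lemma sum_bmnm_eq d (E : 'X_{1..n} -> k) m : (mdeg m < d)%N ->
  \sum_(a : 'X_{1..n < d}) E a * (m == a)%:R = E m.
Proof.
move=> lt_md; rewrite (bigD1 (BMultinom lt_md)) //= eqxx mulr1 big1 ?addr0 //.
by move=> a; rewrite bmeqP eq_sym => /negPf /= ->; rewrite mulr0.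
Qed.

Lemma sum_bmnm_sub d (E : 'X_{1..n} -> k) m m' : (mdeg m < d)%N ->
  \sum_(a : 'X_{1..n < d}) E a * (m == (a + m')%MM)%:R =
  if (m' <= m)%MM then E (m - m')%MM else 0.
Proof.
move=> lt_md; case: ifPn => [le|nle].
  rewrite -[RHS](@sum_bmnm_eq d); last exact: leq_ltn_trans (mdegB _ _) lt_md.
  apply: eq_bigr => a _; congr (_ * _%:R); congr nat_of_bool.
  by apply/eqP/eqP => [->|<-]; rewrite ?addmK ?submK.
rewrite big1 // => a _; case: eqP nle => [->|]; last by rewrite mulr0.
by rewrite lem_addl.
Qed.

Lemma mcoeff_msize_ge F m : (msize F <= mdeg m)%N -> F@_m = 0.
Proof. by move/msize_mdeg_ge/memN_msupp_eq0. Qed.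

(** Any bound [d] on the degree may be used, so contractions of different polynomials can be
    compared over one index set, without reference to supports. *)
Lemma mcoeff_contract d f F m : (msize F <= d)%N ->
  (contract f F)@_m = \sum_(a : 'X_{1..n < d}) f a * F@_(a + m)%MM.
Proof.
move=> le_Fd.
transitivity (\sum_(a : 'X_{1..n < d}) \sum_(b <- msupp F)
    f a * F@_b * (b == (a + m)%MM)%:R); last first.
  apply: eq_bigr => a _; rewrite [in RHS](mpolyE F) raddf_sum mulr_sumr.
  by apply: eq_bigr => b _; rewrite /= mcoeffZ mcoeffX mulrA.
rewrite exchange_big raddf_sum; apply: eq_big_seq => b b_F /=.
have lt_bd := leq_trans (msize_mdeg_lt b_F) le_Fd.
rewrite (sum_bmnm_sub (fun a => f a * F@_b)) // raddf_sum /=.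
rewrite -(sum_bmnm_sub (fun a => f a * F@_b) m (ltnSn (mdeg b))) big_mkcond /=.
apply: eq_bigr => a _; move: (bmnm a) => {}a; case: ifPn => [le|nle].
  rewrite mcoeffZ mcoeffX; congr (_ * _%:R); congr nat_of_bool.
  by apply/eqP/eqP => [<-|->]; rewrite addmC ?submK ?addmK.
by case: eqP nle => [->|]; rewrite ?mulr0 // lem_addr.
Qed.

Lemma contractDl f g F : contract (f + g) F = contract f F + contract g F.
Proof.
apply/mpolyP => m; rewrite mcoeffD !(mcoeff_contract (d := msize F)) //.
by rewrite -big_split; apply: eq_bigr => a _; rewrite mulrDl.
Qed.

Lemma contractD f F G : contract f (F + G) = contract f F + contract f G.
Proof.
apply/mpolyP => m; pose d := maxn (msize (F + G)) (maxn (msize F) (msize G)).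
rewrite mcoeffD !(mcoeff_contract (d := d)) /d ?leq_max ?leqnn ?orbT //.
by rewrite -big_split; apply: eq_bigr => a _; rewrite mcoeffD mulrDr.
Qed.

Lemma contractZ f c F : contract f (c *: F) = c *: contract f F.
Proof.
apply/mpolyP => m; pose d := maxn (msize (c *: F)) (msize F).
rewrite mcoeffZ !(mcoeff_contract (d := d)) /d ?leq_max ?leqnn ?orbT //.
by rewrite mulr_sumr; apply: eq_bigr => a _; rewrite mcoeffZ mulrCA.
Qed.

Fact contract_is_linear f : linear (contract f).
Proof. by move=> c F G; rewrite contractD contractZ. Qed.

HB.instance Definition _ f :=
  GRing.isLinear.Build k S S *:%R (contract f) (contract_is_linear f).

Lemma contract0l F : contract 0 F = 0.
Proof. by apply: (addIr (contract 0 F)); rewrite -contractDl !add0r. Qed.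

Lemma contract_suml J (r : seq J) (P : pred J) (f : J -> R) F :
  contract (\sum_(i <- r | P i) f i) F = \sum_(i <- r | P i) contract (f i) F.
Proof.
exact: (big_morph (fun f => contract f F) (fun f g => contractDl f g F)
  (contract0l F)).
Qed.

(** Series may be truncated below the degree bound of [F], where the product becomes a product of
    polynomials; the monomials of higher degree annihilate [F]. *)
Lemma contractM f g F : contract (f * g) F = contract f (contract g F).
Proof.
(* Contraction does not raise the degree, so the bound for [F] also serves for the inner
   contraction. *)
have size_g : (msize (contract g F) <= msize F)%N.
  rewrite msizeE; apply/bigmax_leqP_seq => m; rewrite mcoeff_msupp => nz _.
  rewrite ltnNge; apply: contra nz => le_m.
  rewrite (mcoeff_contract (d := msize F)) // big1 // => a _.
  by rewrite mcoeff_msize_ge ?mulr0 // mdegD (leq_trans le_m) ?leq_addl.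
apply/mpolyP => m; set d := msize F in size_g.
rewrite !(mcoeff_contract (d := d)) //.
pose tr (h : R) : S := \sum_(a : 'X_{1..n < d}) h a *: 'X_[a].
have tr_size h : (msize (tr h) <= d)%N.
  rewrite (leq_trans (msize_sum _ _ _)) //; apply/bigmax_leqP => a _.
  by rewrite (leq_trans (msizeZ_le _ _)) // msizeX bmdeg.
have fgE (c : 'X_{1..n < d}) : (f * g) c =
    \sum_(ab : 'X_{1..n < d, d}) f ab.1 * g ab.2 * ((ab.1 + ab.2)%MM == c)%:R.
  transitivity ((tr f * tr g)@_c).
    rewrite mcoeffM; apply: eq_bigr => ab _.
    by rewrite !mcoeff_mpoly // (leq_trans (bmdeg _)) // bmdeg.
  rewrite (mpolywME (k := d)) ?tr_size // raddf_sum /=.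
  apply: eq_bigr => ab _; rewrite mcoeffZ mcoeffX.
  by rewrite !mcoeff_mpoly ?bmdeg.
under eq_bigr do rewrite fgE mulr_suml.
rewrite exchange_big /=.
under [RHS]eq_bigr do rewrite (mcoeff_contract (d := d)) // mulr_sumr.
rewrite [RHS]pair_bigA /=; apply: eq_bigr => -[a b] _ /=.
(* A pair with $|a+b|\ge d$ contributes zero on both sides: $F$ has no such monomial, and no index
   $c$ of degree below $d$ equals $a+b$. *)
have [lt_ab|le_ab] := ltnP (mdeg (a + b)%MM) d.
  have := sum_bmnm_eq (fun c => f a * g b * F@_(c + m)%MM) lt_ab.
  rewrite addmA [(b + a)%MM]addmC mulrA => <-.
  by apply: eq_bigr => c _; rewrite mulrAC.
rewrite addmA [(b + a)%MM]addmC mcoeff_msize_ge ?mulr0; last first.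
  by rewrite mdegD (leq_trans le_ab) ?leq_addr.
rewrite big1 // => c _; case: eqP => [e|]; last by rewrite mulr0 mul0r.
by move: (bmdeg c); rewrite -e ltnNge le_ab.
Qed.

Lemma pscoef_sum J (r : seq J) (P : pred J) (f : J -> R) m :
  (\sum_(i <- r | P i) f i) m = \sum_(i <- r | P i) f i m.
Proof. exact: (big_morph (fun f : R => f m)). Qed.

(** The series carry only a ring structure here, so scalars of $\mathbf k$ act through this
    operation. *)
Definition psscale (c : k) f : R := MPSeries (fun m => c * f m).

Lemma psscaleAl c f g : psscale c (f * g) = psscale c f * g.
Proof.
by apply: mpseriesP => m; rewrite /= mulr_sumr; apply: eq_bigr => ab _;
  rewrite /= mulrA.
Qed.

Lemma psscaleE c f : psscale c f = psscale c 1 * f.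
Proof. by rewrite -psscaleAl mul1r. Qed.

Lemma ideal_psscale (J : set R) c f : is_ideal J -> J f -> J (psscale c f).
Proof. by case=> _ _ JM Jf; rewrite psscaleE; apply: JM. Qed.

Lemma ideal_sum (J : set R) A (r : seq A) (P : pred A) (f : A -> R) :
  is_ideal J -> (forall i, P i -> J (f i)) -> J (\sum_(i <- r | P i) f i).
Proof. by case=> J0 JD _ Jf; apply: (big_ind J). Qed.

Lemma contract_psscale c f F : contract (psscale c f) F = c *: contract f F.
Proof.
apply/mpolyP => m; rewrite mcoeffZ !(mcoeff_contract (d := msize F)) //.
by rewrite mulr_sumr; apply: eq_bigr => a _; rewrite mulrA.
Qed.

Lemma mcoeff_contract_psmon (u : 'X_{1..n}) F m :
  (contract (psmon u) F)@_m = F@_(u + m)%MM.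
Proof.
rewrite (mcoeff_contract (d := maxn (mdeg u).+1 (msize F))) ?leq_maxr //.
rewrite -(sum_bmnm_eq (fun a => F@_(a + m)%MM) (leq_maxl _ (msize F))).
by apply: eq_bigr => a _ /=; rewrite mulrC eq_sym.
Qed.

Lemma contract1 F : contract 1 F = F.
Proof. by apply/mpolyP => m; rewrite mcoeff_contract_psmon add0m. Qed.

Lemma contractBl f g F : contract (f - g) F = contract f F - contract g F.
Proof.
by apply: (addIr (contract g F)); rewrite -contractDl !subrK.
Qed.

(** Reduces questions on all coefficients to the pairing $(f,F)\mapsto (f\circ F)_0$, on which the
    duality rests. *)
Lemma mcoeff_contract0 f F m :
  (contract f F)@_m = (contract (psmon m * f) F)@_0%MM.
Proof. by rewrite contractM mcoeff_contract_psmon addm0. Qed.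

(** The power $\mathfrak m^N$, encoded by order of vanishing so that membership is tested on
    coefficients. *)
Definition ord_ge N : set R := [set f | forall m, (mdeg m < N)%N -> f m = 0].

Lemma ord_geM i j f g : ord_ge i f -> ord_ge j g -> ord_ge (i + j) (f * g).
Proof.
move=> fi gj m lt_m; rewrite /= big1 // => -[a b] /= /eqP.
move: (bmnm a) (bmnm b) => {}a {}b m_ab.
have [/fi ->|le_ia] := ltnP (mdeg a) i; first by rewrite mul0r.
rewrite gj ?mulr0 // -(ltn_add2l i) (leq_ltn_trans _ lt_m) //.
by rewrite m_ab mdegD leq_add2r.
Qed.

Lemma ord_geX i f N : ord_ge i f -> ord_ge (N * i) (f ^+ N).
Proof.
move=> fi; elim: N => [|N IH]; first by move=> m; rewrite mul0n.
by rewrite exprS mulSn; apply: ord_geM.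
Qed.

Lemma frak_mE : @frak_m n k = ord_ge 1.
Proof.
apply/seteqP; split=> f f0 => [m|]; last by apply: f0; rewrite mdeg0.
by rewrite ltnS leqn0 mdeg_eq0 => /eqP ->.
Qed.

Lemma contract_ord_ge N f F : ord_ge N f -> (msize F <= N)%N ->
  contract f F = 0.
Proof.
move=> fN le_FN; apply/mpolyP => m.
rewrite mcoeff0 (mcoeff_contract (d := N)) // big1 // => a _.
by rewrite fN ?mul0r ?bmdeg.
Qed.

Lemma psmonM (u : 'X_{1..n}) f m :
  (psmon u * f) m = if (u <= m)%MM then f (m - u)%MM else 0.
Proof.
rewrite /=; case: ifPn => [le_um|nle].
  have lt_u : (mdeg u < (mdeg m).+1)%N by rewrite ltnS -(submK le_um) mdegD leq_addl.
  have lt_b : (mdeg (m - u)%MM < (mdeg m).+1)%N by rewrite ltnS mdegB.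
  rewrite (bigD1 (BMultinom lt_u, BMultinom lt_b)) /=; last first.
    by rewrite addmC submK.
  rewrite eqxx mul1r big1 ?addr0 // => -[a b] /= /andP[/eqP m_ab ne_ab].
  case: eqP => [a_u|]; last by rewrite mul0r.
  case/eqP: ne_ab; congr pair; apply: val_inj => //=.
  rewrite -a_u; move: (bmnm a) (bmnm b) m_ab => {a_u}a {}b ->.
  by rewrite addmC addmK.
rewrite big1 // => -[a b] /= /eqP m_ab; case: eqP => [a_u|]; last by rewrite mul0r.
by case/negP: nle; rewrite m_ab -a_u lem_addr.
Qed.

(* The monomials of [f] are distributed among the [x_i] according to the least
   variable occurring in them. *)
Lemma ord_ge_psX N f : ord_ge N.+1 f ->
  exists2 g : 'I_n -> R, forall i, ord_ge N (g i) &
    f = \sum_i psX i * g i.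
Proof.
move=> fN; exists (fun i : 'I_n => MPSeries (fun m =>
    if [forall j : 'I_n, (j < i)%N ==> (m j == 0%N)] then f (m + U_(i))%MM
    else 0)) => [i m lt_m /=|].
  by case: ifP => // _; rewrite fN // mdegD mdeg1 addn1.
apply: mpseriesP => m; rewrite pscoef_sum.
under eq_bigr do rewrite psmonM lep1mP.
have [m0|] := eqVneq m 0%MM.
  by rewrite m0 fN ?mdeg0 // big1 // => i _; rewrite mnm0E eqxx.
case: (pickP (fun i => m i != 0%N)) => [i0 mi0 _|m0 /eqP[]]; last first.
  by apply/mnmP => i; rewrite mnm0E; apply/eqP/negbFE/m0.
case: (@arg_minnP _ i0 (fun i => m i != 0%N) (fun i => i : nat) mi0) => i mi min_i.
rewrite (bigD1 i) //= mi submK ?lep1mP // big1 ?addr0 => [|j ne_ji].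
  case: ifP => // /negP[]; apply/forallP => j; apply/implyP => lt_ji.
  rewrite mnmBE subn_eq0 mnm1E; apply: contraTT lt_ji.
  rewrite -ltnNge -leqNgt => lt_m; apply: min_i.
  by rewrite -lt0n (leq_ltn_trans _ lt_m).
case: ifP => // mj; case: ifP => // /forallP /(_ i).
have lt_ij : (i < j)%N by rewrite ltn_neqAle min_i // andbT eq_sym.
by rewrite lt_ij mnmBE mnm1E (negPf ne_ji) subn0 (negPf mi).
Qed.

Lemma ord_ge_ideal_exp N : ord_ge N `<=` ideal_exp (@frak_m n k) N.
Proof.
elim: N => [//|N IH] f /ord_ge_psX[g gN ->] J [idJ sub_J].
apply: ideal_sum => // i _; apply: sub_J; exists (psX i), (g i).
split=> //; last exact: IH.
by rewrite /frak_m /= eq_sym mnm1_eq0.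
Qed.

(** Isolates the linear part of [f]: when [F] lies in $\int_{\mathfrak m^2}I^\perp$, the remainder
    [g] sends it into $I^\perp$. *)
Lemma contract_linear_part f F : ord_ge 1 f ->
  exists2 g, ord_ge 2 g &
    contract f F =
      \sum_i f U_(i)%MM *: contract (psX i) F + contract g F.
Proof.
move=> f1; exists (f - \sum_i psscale (f U_(i)%MM) (psX i)); last first.
  rewrite contractBl contract_suml addrC.
  by under [X in _ - X]eq_bigr do rewrite contract_psscale; rewrite subrK.
move=> m; rewrite ltnS leq_eqVlt => /orP[|lt_m]; rewrite /= pscoef_sum /=.
  move=> /mdeg1P[j /eqP ->]; rewrite (bigD1 j) //= eqxx mulr1 big1 ?addr0 ?subrr //.
  by move=> i /negPf ij; rewrite eq_mnm1 eq_sym ij mulr0.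
rewrite f1 // big1 ?subr0 // => i _; move: lt_m; rewrite ltnS leqn0 mdeg_eq0.
by move=> /eqP ->; rewrite eq_sym mnm1_eq0 mulr0.
Qed.

Lemma contract_monomials d f F : (forall g, ord_ge d g -> contract g F = 0) ->
  contract f F = \sum_(a : 'X_{1..n < d}) f a *: contract (psmon a) F.
Proof.
move=> Fd; pose g := \sum_(a : 'X_{1..n < d}) psscale (f a) (psmon a).
have /Fd : ord_ge d (f - g).
  move=> m lt_m; rewrite /= pscoef_sum /= (sum_bmnm_eq (fun a => f a)) //.
  by rewrite subrr.
move/eqP; rewrite contractBl subr_eq0 => /eqP ->; rewrite contract_suml.
by apply: eq_bigr => a _; rewrite contract_psscale.
Qed.

(** After normalisation [f] is $1-u$ with $u\in\mathfrak m$. Since $u^N$ kills [F] for large $N$, a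
    finite geometric sum inverts [f] on [F]. *)
Lemma contract_unit f F : f 0%MM != 0 -> exists g, contract (g * f) F = F.
Proof.
move=> f0; pose u := 1 - psscale (f 0%MM)^-1 f.
have u1 : ord_ge 1 u by rewrite -frak_mE /frak_m /= eqxx mulVf ?subrr.
pose N := msize F.
exists ((\sum_(i < N) u ^+ i) * psscale (f 0%MM)^-1 1).
rewrite -mulrA -psscaleE -[psscale _ _](subKr 1) -/u mulrC -opprB mulNr -subrX1.
rewrite opprB contractBl contract1 (contract_ord_ge (N := N)) ?subr0 //.
by have := ord_geX (N := N) u1; rewrite muln1.
Qed.

End Contraction.

(** * Minors, and length as dimension *)

Section LinearAlgebra.
Context {k : fieldType}.

(** Take a matrix of maximal rank among those whose row space lies in [W]: a vector of [W] outside
    the row space could be adjoined and would raise the rank. *)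
Lemma subspace_rowspace d (W : set 'rV[k]_d) :
  W 0 -> (forall x y, W x -> W y -> W (x + y)) ->
  (forall c x, W x -> W (c *: x)) ->
  exists A : 'M[k]_d, forall x, W x <-> (x <= A)%MS.
Proof.
move=> W0 WD WZ.
pose P r := `[< exists2 A : 'M[k]_d, (forall x, (x <= A)%MS -> W x) & \rank A = r >].
have exP : exists r, P r.
  exists 0%N; apply/asboolP; exists 0; last exact: mxrank0.
  by move=> x; rewrite submx0 => /eqP ->.
have ubP r : P r -> (r <= d)%N by move=> /asboolP[A _ <-]; apply: rank_leq_row.
have [r /asboolP[A AW rA] max_r] := ex_maxnP exP ubP; exists A => x.
split=> [Wx|/AW//]; apply: contraT => nxA.
suff /max_r : P (\rank (A + x)%MS).
  rewrite -rA leqNgt => /negP[]; apply: rank_ltmx.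
  by rewrite /ltmx addsmxSl addsmx_sub submx_refl.
apply/asboolP; exists (A + x)%MS => // y /sub_addsmxP[[a c] /= ->].
apply: WD; first by apply: AW; rewrite submxMl.
by rewrite [c]mx11_scalar mul_scalar_mx; apply: WZ.
Qed.

Lemma row_free_rowsub p q r (h : 'I_r -> 'I_p) (M : 'M[k]_(p, q)) :
  injective h -> row_free M -> row_free (rowsub h M).
Proof.
move=> h_inj /row_freeP[X MX]; apply/row_freeP; exists (X *m (rowsub h 1%:M)^T).
rewrite mulmxA mul_rowsub_mx MX; apply/matrixP => i j; rewrite !mxE.
rewrite (bigD1 (h i)) //= !mxE eqxx mul1r big1 ?addr0 => [|l /negPf nl].
  by rewrite (inj_eq h_inj) eq_sym.
by rewrite !mxE eq_sym nl mul0r.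
Qed.

Lemma enum_val_ltn p (A : {pred 'I_p}) (i j : 'I_#|A|) :
  (i < j)%N -> (enum_val i < enum_val j)%N.
Proof.
move=> lt_ij; have x0 := enum_val i; rewrite !(enum_val_nth x0).
rewrite -!(nth_map x0 0%N val) ?size_map -?cardE //.
apply: (sorted_ltn_nth ltn_trans) => //; rewrite ?inE ?size_map -?cardE //.
rewrite {1}/enum_mem -enumT; apply: (subseq_sorted ltn_trans).
  exact: map_subseq (filter_subseq _ _).
by rewrite val_enum_ord iota_ltn_sorted.
Qed.

(** [minors] asks for increasing index maps, while [maxrankfun] chooses independent rows in no
    particular order; the chosen rows are therefore enumerated again in increasing order. *)
Lemma increasing_row_free p q r (M : 'M[k]_(p, q)) : (r <= \rank M)%N ->
  exists2 f : 'I_r -> 'I_p, {homo f : i j / (i < j)%N} &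
    row_free (rowsub f M).
Proof.
move=> le_r; pose f1 (i : 'I_r) : 'I_p := maxrankfun M (widen_ord le_r i).
have f1_inj : injective f1.
  by move=> i j /maxrankfun_inj /(congr1 val) /= /val_inj.
have cA : #|codom f1| = r by rewrite card_codom ?card_ord.
pose f i := enum_val (cast_ord (esym cA) i); exists f => [i j lt_ij|].
  exact: enum_val_ltn.
have /all_sig[h fh] i : {j | f i = f1 j}.
  by have /codomP/cid[j fj] := enum_valP (cast_ord (esym cA) i); exists j; exact: fj.
rewrite (_ : rowsub f M = rowsub (widen_ord le_r \o h) (rowsub (maxrankfun M) M)).
  apply: row_free_rowsub (maxrowsub_free M) => i j /= /(congr1 val) /= /val_inj.
  by move=> eq_h; have := fh i; rewrite eq_h -fh => /enum_val_inj /cast_ord_inj.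
by apply/matrixP => i j; rewrite !mxE fh.
Qed.

(** If the rank is at least [r], choosing independent rows and then, after transposition,
    independent columns gives a nonzero minor. Conversely a submatrix has no larger rank. *)
Lemma minors_rank p q r (M : 'M[k]_(p, q)) :
  (minors r M `<=` [set 0]) <-> (\rank M < r)%N.
Proof.
split=> [M0|lt_rM _ [f [g [_ _ ->]]]].
  rewrite ltnNge; apply/negP => /increasing_row_free[f f_homo freef].
  have : (r <= \rank (rowsub f M)^T)%N by rewrite mxrank_tr (eqP freef).
  move=> /increasing_row_free[g g_homo].
  rewrite row_free_unit unitmxE unitfE => /eqP[]; apply: M0; exists f, g.
  by split=> //; rewrite -det_tr; congr (\det _); apply/matrixP => i j; rewrite !mxE.
rewrite /=; apply/eqP; apply: contraTT lt_rM => nz; rewrite -leqNgt.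
have : mxsub f g M \in unitmx by rewrite unitmxE unitfE.
rewrite -row_free_unit => /eqP {1}<-.
have -> : mxsub f g M = rowsub f (rowsub g M^T)^T.
  by apply/matrixP => i j; rewrite !mxE.
rewrite (leq_trans (mxrankS (rowsub_sub _ _))) // mxrank_tr.
by rewrite (leq_trans (mxrankS (rowsub_sub _ _))) // mxrank_tr.
Qed.
End LinearAlgebra.

Section Basis.
Context {n : nat} {k : fieldType}.
Local Notation R := (mpseries n k).
Local Notation S := {mpoly k[n]}.

Lemma coordsE m (X : 'I_m -> S) M G : is_kbasis X M -> M G ->
  G = \sum_i coords X G 0 i *: X i.
Proof.
move=> [_ _ gen] /gen[c Gc]; rewrite /coords.
by case: xgetP => [? -> //|/(_ (\row_i c i)) []] /=; rewrite Gc;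
   apply: eq_bigr => i _; rewrite mxE.
Qed.

Lemma kbasis_inj m (X : 'I_m -> S) M (c d : 'I_m -> k) : is_kbasis X M ->
  \sum_i c i *: X i = \sum_i d i *: X i -> c =1 d.
Proof.
move=> [_ free _] /eqP; rewrite -subr_eq0 -sumrB => /eqP eq0 i.
apply/eqP; rewrite -subr_eq0; apply/eqP; apply: (free (fun i => c i - d i)).
by rewrite -[RHS]eq0; apply: eq_bigr => j _; rewrite scalerBl.
Qed.

Lemma quotient_length_uniq (I : set R) l l' :
  quotient_length I l -> quotient_length I l' -> l = l'.
Proof.
by move=> [c m] [c' m']; apply/eqP; rewrite eqn_leq m' ?m.
Qed.

(** * Length of $R/J$ from a linear surjection onto $\mathbf k^d$ with kernel $J$ *)

Section Length.
Variables (d N : nat) (J : set R) (phi : R -> 'rV[k]_d).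
Hypothesis idJ : is_ideal J.
Hypothesis ordJ : ord_ge N `<=` J.
Hypothesis phiD : {morph phi : f g / f + g}.
Hypothesis phiZ : forall c f, phi (psscale c f) = c *: phi f.
Hypothesis phi_surj : forall v, exists f, phi f = v.
Hypothesis phi_ker : forall f, phi f = 0 <-> J f.

Let phiB f g : phi (f - g) = phi f - phi g.
Proof. by apply: (addIr (phi g)); rewrite -phiD !subrK. Qed.

(** An ideal containing [J] is the preimage of its image under [phi]. The conditions on [K] stand
    under the existential so that [mx] can be chosen for every set. *)
Let rows (K : set R) : exists A : 'M[k]_d, is_ideal K -> J `<=` K ->
  forall f, K f <-> (phi f <= A)%MS.
Proof.
have [[idK JK]|nK] := pselect (is_ideal K /\ J `<=` K); last first.
  by exists 0 => idK JK; case: nK.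
have [K0 KD KM] := idK.
have [||c x|A HA] := @subspace_rowspace k d [set phi f | f in K].
- by exists 0 => //; apply/phi_ker; case: idJ.
- by move=> _ _ [f Kf <-] [g Kg <-]; exists (f + g); [apply: KD|rewrite phiD].
- by case=> f Kf <-; exists (psscale c f); [apply: ideal_psscale|rewrite phiZ].
exists A => _ _ f; rewrite -HA; split=> [Kf|[g Kg eq_fg]]; first by exists f.
rewrite -[f](subrK g); apply: KD => //; apply/JK/phi_ker.
by rewrite phiB eq_fg subrr.
Qed.

Let mx K : 'M[k]_d := sval (cid (rows K)).
Let mxP K : is_ideal K -> J `<=` K -> forall f, K f <-> (phi f <= mx K)%MS.
Proof. exact: (svalP (cid (rows K))). Qed.

Let mx_sub K (A : 'M[k]_d) : is_ideal K -> J `<=` K ->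
  (forall f, K f -> (phi f <= A)%MS) -> (mx K <= A)%MS.
Proof.
move=> idK JK KA; apply/row_subP => i; have [f ef] := phi_surj (row i (mx K)).
by rewrite -ef; apply: KA; apply/mxP => //; rewrite ef row_sub.
Qed.

Let rank_mono K K' : is_ideal K -> J `<=` K -> is_ideal K' -> K `<` K' ->
  (\rank (mx K) < \rank (mx K'))%N.
Proof.
move=> idK JK idK' [KK' nK]; have JK' := subset_trans JK KK'.
apply: rank_ltmx; rewrite /ltmx mx_sub //=; last first.
  by move=> f Kf; apply/mxP => //; apply: KK'.
apply/negP => le; apply: nK => f K'f; apply/mxP => //.
by apply: submx_trans le; apply/mxP.
Qed.

(** Along a strict chain the ranks of the images increase strictly, and they are at most [d]. *)
Let chain_bound l : ideal_chain J l -> (l <= d)%N.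
Proof.
move=> [c [c0 _ idc ltc]].
suff H i : (i <= l)%N -> J `<=` c i /\ (i <= \rank (mx (c i)))%N.
  by have [_ le] := H l (leqnn l); apply: leq_trans le (rank_leq_row _).
elim: i => [_|i IH lt_il]; first by rewrite c0; split.
have [Jc le_i] := IH (ltnW lt_il).
split; first by apply: subset_trans Jc _; case: (ltc _ lt_il).
apply: leq_ltn_trans le_i _; apply: rank_mono => //; last exact: ltc.
- exact/idc/ltnW.
- exact: idc.
Qed.

(* The sum of [K] and of the line spanned by an element of [K : m] outside [K]
   is an ideal covering [K]. *)
Let ideal_step K : is_ideal K -> J `<=` K -> (\rank (mx K) < d)%N ->
  exists K', [/\ is_ideal K', K `<` K' & \rank (mx K') = (\rank (mx K)).+1].
Proof.
move=> idK JK rK; have [K0 KD KM] := idK.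
have [f0 nKf0] : exists f, ~ K f.
  apply: contrapT => allK; have : (1%:M <= mx K)%MS.
    apply/row_subP => i; have [f <-] := phi_surj (row i 1%:M).
    by apply/mxP => //; apply: contrapT => nKf; apply: allK; exists f.
  by move/mxrankS; rewrite mxrank1 leqNgt rK.
(* With $i+1$ the least exponent such that $\mathfrak m^{i+1}\subset K$, any $f\in\mathfrak
   m^i\setminus K$ satisfies $\mathfrak m f\subset K$. *)
have [i [f [fi nKf mK]]] : exists i f, [/\ ord_ge i f, ~ K f &
    ord_ge i.+1 `<=` K].
  have : exists j, `[< ord_ge j `<=` K >].
    by exists N; apply/asboolP/(subset_trans ordJ).
  case/ex_minnP => -[|i] /asboolP iK min_i; first by case: nKf0; apply: iK.
  have : ~ (ord_ge i `<=` K) by move=> /asboolP /min_i; rewrite ltnn.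
  by move=> /existsNP[f /not_implyP[fi nKf]]; exists i, f.
pose K' := [set g | exists c, K (g - psscale c f)].
have KK' : K `<=` K'.
  move=> g Kg; exists 0; rewrite psscaleE (_ : psscale 0 1 = 0) ?mul0r ?subr0 //.
  by apply: mpseriesP => m; rewrite /= mul0r.
have K'f : K' f.
  exists 1; rewrite (_ : psscale 1 f = f) ?subrr //.
  by apply: mpseriesP => m; rewrite /= mul1r.
have idK' : is_ideal K'.
  split=> [|x y [c Kc] [c' Kc']|a x [c Kc]]; first exact: KK'.
    exists (c + c'); suff -> : x + y - psscale (c + c') f =
      (x - psscale c f) + (y - psscale c' f) by apply: KD.
    by rewrite addrACA -opprD; congr (_ - _); apply: mpseriesP => m;
      rewrite /= mulrDl.
  (* Modulo [K] the series [a] acts on [f] through its constant term, because the rest of [a] lies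
     in $\mathfrak m$. *)
  exists (a 0%MM * c); suff -> : a * x - psscale (a 0%MM * c) f =
      a * (x - psscale c f) + psscale c 1 * ((a - psscale (a 0%MM) 1) * f).
    apply: KD; [exact: KM|apply/KM/mK; rewrite -add1n; apply: ord_geM => //].
    by rewrite -frak_mE /frak_m /= eqxx mulr1 subrr.
  have -> : psscale (a 0%MM * c) f = psscale c 1 * (psscale (a 0%MM) 1 * f).
    by rewrite -!psscaleE; apply: mpseriesP => m; rewrite /= mulrA [c * _]mulrC.
  rewrite (psscaleE c f) mulrBr mulrBl mulrBr [a * (_ * _)]mulrCA.
  by rewrite addrA subrK.
have ltK : K `<` K' by split=> // K'K; apply/nKf/K'K.
exists K'; split=> //; apply/eqP; rewrite eqn_leq rank_mono // andbT.
have /mxrankS /leq_trans -> // : (mx K' <= mx K + phi f)%MS.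
  apply: mx_sub => // [|g [c Kc]]; first exact: subset_trans KK'.
  rewrite -[g](subrK (psscale c f)) phiD phiZ; apply: addmx_sub_adds.
    exact/mxP.
  exact: scalemx_sub.
rewrite (leq_trans (mxrank_adds_leqif _ _)) // -[X in (_ <= X)%N]addn1 leq_add2l.
exact: rank_leq_row.
Qed.

(** Induction on the codimension [e] of the image of [K], with [ideal_step] supplying one link at a
    time. *)
Let chain_exists e K : is_ideal K -> J `<=` K -> (\rank (mx K) + e = d)%N ->
  ideal_chain K e.
Proof.
elim: e K => [|e IH] K idK JK rK.
  exists (fun=> K); split=> //; apply/seteqP; split=> // f _; apply/mxP => //.
  by rewrite (submx_trans (submx1 _)) // sub1mx /row_full -{3}rK addn0.
have [|K' [idK' ltK rK']] := ideal_step idK JK.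
  by apply: leq_trans (eq_leq rK); rewrite addnS ltnS leq_addr.
have [||c [c0 cl idc ltc]] := IH K' idK'.
- by apply: subset_trans JK _; case: ltK.
- by rewrite rK' addSnnS.
exists (fun i => if i is j.+1 then c j else K); split=> //.
  by case=> // i; apply: idc.
by case=> [_|i]; [rewrite c0|apply: ltc].
Qed.

Lemma quotient_length_linear : quotient_length J d.
Proof.
split; last exact: chain_bound.
apply: chain_exists => //; suff -> : mx J = 0 by rewrite mxrank0.
apply/eqP; rewrite -submx0; apply: mx_sub => // f Jf.
by rewrite (_ : phi f = 0) ?sub0mx //; apply/phi_ker.
Qed.

End Length.

End Basis.

(** * Macaulay duality *)

Section LinearCombinations.
Context {n : nat} {k : fieldType}.
Local Notation S := {mpoly k[n]}.

(** Coefficients form a row vector, so that changes of family become matrix products. *)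
Definition lc m (X : 'I_m -> S) (c : 'rV[k]_m) : S := \sum_i c 0 i *: X i.

Fact lc_is_linear m (X : 'I_m -> S) : linear (lc X).
Proof.
move=> a c d; rewrite /lc scaler_sumr -big_split; apply: eq_bigr => i _.
by rewrite !mxE scalerDl scalerA.
Qed.

HB.instance Definition _ m (X : 'I_m -> S) :=
  GRing.isLinear.Build k 'rV[k]_m S *:%R (lc X) (lc_is_linear X).

Lemma lc_catf p q (X : 'I_p -> S) (Y : 'I_q -> S) c d :
  lc (catf X Y) (row_mx c d) = lc X c + lc Y d.
Proof.
rewrite /lc big_split_ord /catf /=; congr (_ + _); apply: eq_bigr => i _.
  by rewrite row_mxEl (unsplitK (inl i)).
by rewrite row_mxEr (unsplitK (inr i)).
Qed.

Lemma lc_closed m (X : 'I_m -> S) (M : set S) c :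
  M 0 -> (forall x y, M x -> M y -> M (x + y)) ->
  (forall a x, M x -> M (a *: x)) -> (forall i, M (X i)) -> M (lc X c).
Proof.
move=> M0 MD MZ MX; rewrite /lc; apply: (big_ind M) => // i _; exact: MZ.
Qed.

Section KBasis.
Variables (m : nat) (X : 'I_m -> S) (M : set S).
Hypothesis bX : is_kbasis X M.

Lemma kbasis_lc c d : lc X c = lc X d -> c = d.
Proof. by move/(kbasis_inj bX) => cd; apply/rowP. Qed.

Lemma kbasis_lc_eq0 c : lc X c = 0 -> c = 0.
Proof. by rewrite -(linear0 (lc X)) => /kbasis_lc. Qed.

Lemma lc_coords G : M G -> lc X (coords X G) = G.
Proof. by move/(coordsE bX) => {2}->. Qed.

Lemma coords_eq G c : G = lc X c -> M G -> coords X G = c.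
Proof. by move=> -> MG; apply: kbasis_lc; rewrite lc_coords. Qed.

End KBasis.

Lemma is_kbasisP m (X : 'I_m -> S) M :
  (forall i, M (X i)) -> (forall c, lc X c = 0 -> c = 0) ->
  (forall G, M G -> exists c, G = lc X c) -> is_kbasis X M.
Proof.
move=> MX free gen; split=> // [c c0 i|G /gen[c ->]].
  have /rowP/(_ i) : \row_j c j = 0.
    by apply: free; rewrite -[RHS]c0; apply: eq_bigr => j _; rewrite mxE.
  by rewrite !mxE.
by exists (c 0).
Qed.

End LinearCombinations.

(** * Lengths of $R/\mathrm{Ann}\,H$ and of $R/I$ *)

Section Lengths.
Context {n : nat} {k : fieldType}.
Local Notation R := (mpseries n k).
Local Notation S := {mpoly k[n]}.
Implicit Types (I : set R) (f g : R) (G H : S).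

Lemma cyc0 H : cyc H 0.
Proof. by exists 0; rewrite contract0l. Qed.

Lemma cycD H x y : cyc H x -> cyc H y -> cyc H (x + y).
Proof. by case=> f -> [g ->]; exists (f + g); rewrite contractDl. Qed.

Lemma cycZ H a x : cyc H x -> cyc H (a *: x).
Proof. by case=> f ->; exists (psscale a f); rewrite contract_psscale. Qed.

Lemma cyc_contract H f : cyc H (contract f H).
Proof. by exists f. Qed.

Lemma perp0 I : perp I 0.
Proof. by move=> f _; rewrite linear0. Qed.

Lemma perpD I x y : perp I x -> perp I y -> perp I (x + y).
Proof. by move=> Ix Iy f If; rewrite linearD /= Ix ?Iy ?addr0. Qed.

Lemma perpZ I a x : perp I x -> perp I (a *: x).
Proof. by move=> Ix f If; rewrite linearZ /= Ix ?scaler0. Qed.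

Lemma perp_contract I f x : perp I x -> perp I (contract f x).
Proof. by move=> Ix g Ig; rewrite -contractM mulrC contractM Ix ?linear0. Qed.

(** Contraction against [H] identifies $R/\mathrm{Ann}\,H$ with $\langle H\rangle$; coordinates on
    [e] give the linear surjection. *)
Lemma quotient_length_Ann d (e : 'I_d -> S) H : is_kbasis e (cyc H) ->
  quotient_length (Ann H) d.
Proof.
move=> be.
have phiE f : lc e (coords e (contract f H)) = contract f H.
  by apply: (lc_coords be); apply: cyc_contract.
apply: (@quotient_length_linear _ _ d (msize H) _
  (fun f => coords e (contract f H))).
- split=> [|f g|f g]; rewrite /Ann /= ?contract0l ?contractDl ?contractM //.
    by move=> -> ->; rewrite addr0.
  by move=> ->; rewrite linear0.
- by move=> f fN; apply: contract_ord_ge fN _.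
- by move=> f g; apply: (kbasis_lc be); rewrite linearD /= !phiE contractDl.
- move=> c f; apply: (kbasis_lc be).
  by rewrite linearZ /= !phiE contract_psscale.
- move=> v; have [f fv] : cyc H (lc e v).
    by apply: lc_closed; [apply: cyc0|apply: cycD|apply: cycZ|case: be].
  by exists f; apply: (kbasis_lc be); rewrite phiE.
- move=> f; split=> [f0|/= ->]; first by rewrite /Ann /= -phiE f0 linear0.
  by apply: (kbasis_lc_eq0 be); rewrite (lc_coords be) //; apply: cyc0.
Qed.

Lemma contract_mono0 f (m : 'X_{1..n}) : (contract f 'X_[m])@_0%MM = f m.
Proof.
rewrite (mcoeff_contract (d := (mdeg m).+1)) ?msizeX //.
rewrite -(@sum_bmnm_eq _ _ (mdeg m).+1 f) //.
by apply: eq_bigr => a _; rewrite addm0 mcoeffX.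
Qed.

(* Duality in the truncation to degrees [< N]: a functional vanishing on [I]
   but not at [f] is a polynomial of [perp I] not annihilated by [f]. *)
Lemma perp_perp N I f : is_ideal I -> ord_ge N `<=` I ->
  (forall G, perp I G -> (contract f G)@_0%MM = 0) -> I f.
Proof.
move=> idI ordI fperp; have [I0 ID IM] := idI.
pose D := #|{: 'X_{1..n < N}}|.
pose ev (i : 'I_D) : 'X_{1..n < N} := enum_val i.
pose tau g : 'rV[k]_D := \row_i g (ev i).
have tauD g h : tau (g + h) = tau g + tau h by apply/rowP => i; rewrite !mxE.
have [||c x|A HA] := @subspace_rowspace k D [set tau g | g in I].
- by exists 0 => //; apply/rowP => i; rewrite !mxE.
- by move=> _ _ [g Ig <-] [h Ih <-]; exists (g + h); [apply: ID|rewrite tauD].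
- case=> g Ig <-; exists (psscale c g); first exact: ideal_psscale.
  by apply/rowP => i; rewrite !mxE.
apply: contrapT => nIf.
have : ~~ (tau f <= A)%MS.
  apply/negP => /HA[g Ig tau_gf]; apply: nIf; rewrite -[f](subrK g).
  apply: ID => //; apply: ordI => m lt_m /=.
  have /rowP/(_ (enum_rank (BMultinom lt_m : 'X_{1..n < N}))) := tau_gf.
  by rewrite !mxE /ev enum_rankK /= => ->; rewrite subrr.
rewrite submxE => /eqP ntau; apply: ntau; apply/rowP => j; rewrite [RHS]mxE.
pose G := \sum_(i < D) cokermx A i j *: 'X_[ev i] : S.
have pair g : (contract g G)@_0%MM = (tau g *m cokermx A) 0 j.
  rewrite /G (linear_sum (contract g)) raddf_sum mxE; apply: eq_bigr => i _ /=.
  by rewrite contractZ mcoeffZ contract_mono0 [X in _ = X * _]mxE mulrC.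
rewrite -pair; apply: fperp => g Ig; apply/mpolyP => m.
(* Every coefficient of $g\circ G$ is the constant coefficient of $(x^m g)\circ G$, and $x^m g$ is
   again in [I]. *)
rewrite mcoeff_contract0 pair mcoeff0.
suff : (tau (psmon m * g)%R <= A)%MS by rewrite submxE => /eqP ->; rewrite mxE.
by apply/HA; exists (psmon m * g) => //; apply: IM.
Qed.

(** Pairing with the $b_j$ maps $R$ onto $\mathbf k^t$; by [perp_perp] the kernel is exactly [I]. *)
Lemma quotient_length_perp N I t (b : 'I_t -> S) : is_ideal I ->
  ord_ge N `<=` I -> is_kbasis b (perp I) -> quotient_length I t.
Proof.
move=> idI ordI bb; have [Ib _ _] := bb.
pose phi f : 'rV[k]_t := \row_j (contract f (b j))@_0%MM.
have phiD : {morph phi : f g / f + g}.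
  by move=> f g; apply/rowP => j; rewrite !mxE contractDl mcoeffD.
have phiZ c f : phi (psscale c f) = c *: phi f.
  by apply/rowP => j; rewrite !mxE contract_psscale mcoeffZ.
have pair f (c : 'cV_t) : (contract f (lc b c^T))@_0%MM = (phi f *m c) 0 0.
  rewrite /lc (linear_sum (contract f)) raddf_sum mxE; apply: eq_bigr => i _ /=.
  by rewrite contractZ mcoeffZ !mxE mulrC.
apply: (@quotient_length_linear _ _ t N _ phi) => // [v|f].
  have [||c x|A HA] := @subspace_rowspace k t [set phi g | g in setT].
  - by exists 0 => //; apply/rowP => i; rewrite !mxE contract0l mcoeff0.
  - by move=> _ _ [g _ <-] [h _ <-]; exists (g + h).
  - by case=> g _ <-; exists (psscale c g).
  (* A linear relation satisfied by the whole image would give a combination of the $b_j$ all of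
     whose coefficients vanish. *)
  suff /(submx_full v)/HA[f _ <-] : row_full A by exists f.
  rewrite -cokermx_eq0; apply/eqP/trmx_inj; rewrite trmx0; apply/row_matrixP => j.
  rewrite row0; apply: (kbasis_lc_eq0 bb); apply/mpolyP => m.
  rewrite -[m]addm0 -mcoeff_contract_psmon -tr_col pair mcoeff0 colE mulmxA.
  suff : (phi (psmon m) <= A)%MS.
    by rewrite submxE => /eqP ->; rewrite mul0mx mxE.
  by apply/HA; exists (psmon m).
split=> [f0|If]; last by apply/rowP => j; rewrite !mxE Ib ?mcoeff0.
apply: (perp_perp idI ordI) => G /(lc_coords bb) <-.
by rewrite -[coords b G]trmxK pair f0 mul0mx mxE.
Qed.

End Lengths.

(** * Covers *)

Lemma rank_le1_minor (k : fieldType) p q (M : 'M[k]_(p, q)) i i' j j' :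
  (\rank M < 2)%N -> M i j * M i' j' = M i j' * M i' j.
Proof.
move: (col_base M) (row_base M) (mulmx_base M).
case: (\rank M) => [|[|//]] A B <- _; rewrite !mxE ?big_ord0 ?mul0r // !big_ord1.
by rewrite mulrACA [RHS]mulrACA [B _ _ * _]mulrC.
Qed.

Lemma socle_degree_ord_ge n (k : fieldType) (I : set (mpseries n k)) s :
  socle_degree I s -> ord_ge s.+1 `<=` I.
Proof.
move=> [_ max_s]; apply: subset_trans (@ord_ge_ideal_exp n k s.+1) _.
by apply: contrapT => /max_s; rewrite ltnn.
Qed.

Section Cover.
Context {k : fieldType} {n : nat}.
Local Notation R := (mpseries n k).
Local Notation S := {mpoly k[n]}.
Variables (I : set R) (s t h1 h2 : nat).
Variables (b : 'I_t -> S) (F : 'I_h1 -> S) (G : 'I_h2 -> S).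
Hypothesis idI : is_ideal I.
Hypothesis soc : socle_degree I s.
Hypothesis hb : is_kbasis b (perp I).
Hypothesis hF : is_kbasis (catf b F) (integral (@frak_m n k) (perp I)).
Hypothesis hG : is_kbasis (catf (catf b F) G)
  (integral (ideal_exp (@frak_m n k) 2) (perp I)).
Implicit Types (H : S) (u : 'rV[k]_(h1 + h2)) (f g : R).

Let ordI : ord_ge s.+1 `<=` I := socle_degree_ord_ge soc.

Lemma perp_lc c : perp I (lc b c).
Proof.
by case: hb => Ib _ _; apply: lc_closed; [apply: perp0|apply: perpD|apply: perpZ|].
Qed.

Lemma integral_m_psX H : integral (@frak_m n k) (perp I) H ->
  forall i, perp I (contract (psX i) H).
Proof. by move=> mH i; apply: mH; rewrite /frak_m /= eq_sym mnm1_eq0. Qed.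

Lemma integral_m_lc c d :
  integral (@frak_m n k) (perp I) (lc b c + lc F d).
Proof.
rewrite -lc_catf; apply: lc_closed => [f _|x y Hx Hy f mf|a x Hx f mf|].
- by rewrite linear0; apply: perp0.
- by rewrite linearD; apply: perpD; [apply: Hx|apply: Hy].
- by rewrite linearZ; apply/perpZ/Hx.
- by case: hF.
Qed.

Lemma Hof_lc u : Hof F G u = lc (catf F G) u.
Proof. by []. Qed.

(** Membership in $\int_{\mathfrak m^2}I^\perp$, with $\mathfrak m^2$ read through orders. *)
Definition in_integral2 H := forall g, ord_ge 2 g -> perp I (contract g H).

Lemma in_integral2_FG i : in_integral2 (catf F G i).
Proof.
move=> g g2; have {}g2 := ord_ge_ideal_exp g2.
case: hG => mem _ _; rewrite /catf; case: (split i) => j.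
  have := mem (lshift h2 (rshift t j)).
  by rewrite /catf (unsplitK (inl _)) (unsplitK (inr _)); apply.
by have := mem (rshift (t + h1) j); rewrite /catf (unsplitK (inr _)); apply.
Qed.

Lemma in_integral2_Hof u : in_integral2 (Hof F G u).
Proof.
move=> g g2; rewrite Hof_lc /lc (linear_sum (contract g)).
apply: (big_ind (perp I)); [exact: perp0|exact: perpD|] => i _.
by rewrite /= contractZ; apply/perpZ/in_integral2_FG.
Qed.

Lemma integral_m_contract H i : in_integral2 H ->
  integral (@frak_m n k) (perp I) (contract (psX i) H).
Proof.
move=> H2 f; rewrite frak_mE => f1; rewrite -contractM; apply: H2.
rewrite -[2%N]/(1 + 1)%N; apply: ord_geM => //; rewrite -frak_mE /frak_m /=.
by rewrite eq_sym mnm1_eq0.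
Qed.

(** The families $F$ and $G$ are independent modulo the $b_j$, so a nonzero combination of them
    leaves $I^\perp$. *)
Lemma Hof_notin_perp u : u != 0 -> ~ perp I (Hof F G u).
Proof.
move=> u0 /(lc_coords hb) Hu; case/eqP: u0.
have : lc (catf (catf b F) G)
    (row_mx (row_mx (coords b (Hof F G u)) (- lsubmx u)) (- rsubmx u)) = 0.
  rewrite !lc_catf Hu !linearN /= Hof_lc -{1}[u]hsubmxK lc_catf.
  by rewrite -addrA -opprD subrr.
move/(kbasis_lc_eq0 hG); rewrite -row_mx0 => /eq_row_mx[].
rewrite -row_mx0 => /eq_row_mx[_ /eqP]; rewrite oppr_eq0 => /eqP l0.
by move/eqP; rewrite oppr_eq0 => /eqP r0; rewrite -[u]hsubmxK l0 r0 row_mx0.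
Qed.

(** This and [rho_of] are the matrices $(\mu_k^j)$ and $B_H$ of an actual polynomial, the values of
    the generic [mu_mx] and [B_mx]. *)
Definition mu_of H : 'M[k]_(n, t) :=
  \matrix_i lsubmx (coords (catf b F) (contract (psX i) H)).

Definition rho_of H : 'M[k]_(n, h1) :=
  \matrix_i rsubmx (coords (catf b F) (contract (psX i) H)).

Lemma contract_psX H i : in_integral2 H ->
  contract (psX i) H = lc b (row i (mu_of H)) + lc F (row i (rho_of H)).
Proof.
move=> H2; rewrite !rowK -lc_catf hsubmxK (lc_coords hF) //.
exact: integral_m_contract.
Qed.

Lemma sum_contract_psX H (a : 'rV_n) : in_integral2 H ->
  \sum_i a 0 i *: contract (psX i) H =
  lc b (a *m mu_of H) + lc F (a *m rho_of H).
Proof.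
move=> H2; rewrite !mulmx_sum_row !linear_sum -big_split; apply: eq_bigr => i _.
by rewrite contract_psX // scalerDr !linearZ.
Qed.

Lemma kbasis_lcF_eq0 c d : lc b c + lc F d = 0 -> c = 0 /\ d = 0.
Proof.
by rewrite -lc_catf => /(kbasis_lc_eq0 hF); rewrite -row_mx0 => /eq_row_mx.
Qed.

Lemma rho_of_eq0 H : integral (@frak_m n k) (perp I) H -> rho_of H = 0.
Proof.
move=> mH; apply/row_matrixP => i; rewrite row0.
have Hi := integral_m_psX mH i.
have H2 : in_integral2 H.
  move=> g g2; apply: mH; rewrite frak_mE => m lt_m.
  by apply: g2; apply: leq_trans lt_m _.
have : lc b (row i (mu_of H) - coords b (contract (psX i) H)) +
    lc F (row i (rho_of H)) = 0.
  by rewrite linearB /= addrAC -contract_psX // (lc_coords hb Hi) subrr.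
by case/kbasis_lcF_eq0.
Qed.

(** The basis consists of the $b_j$, the combinations of the $F_j$ given by a basis of the row space
    of $B_H$, and [H] itself. *)
Lemma cyc_basis H : in_integral2 H -> ~ perp I H -> gorenstein_cover I H ->
  exists e : 'I_(t + \rank (rho_of H) + 1) -> S, is_kbasis e (cyc H).
Proof.
move=> H2 nH cov; set r := \rank _.
pose F' (i : 'I_r) := lc F (row i (row_base (rho_of H))).
have lcF' c : lc F' c = lc F (c *m row_base (rho_of H)).
  rewrite mulmx_sum_row linear_sum; apply: eq_bigr => i _.
  by rewrite linearZ.
have lcH (c : 'rV_1) : lc (fun _ : 'I_1 => H) c = c 0 0 *: H.
  by rewrite /lc big_ord1.
(* A linear form sends [H] to a $b$-part plus an $F$-part. The $b$-part lies in
   $I^\perp\subset\langle H\rangle$, hence so does the $F$-part. *)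
have cycF a : cyc H (lc F (a *m rho_of H)).
  rewrite -[lc F _](addKr (lc b (a *m mu_of H))) -sum_contract_psX //.
  apply: cycD; first by rewrite -linearN; apply/cov/perp_lc.
  apply: (big_ind (cyc H)); [exact: cyc0|exact: cycD|] => i _.
  exact/cycZ/cyc_contract.
exists (catf (catf b F') (fun=> H)); apply: is_kbasisP => [i|c|_ [f ->]].
- rewrite /catf; case: (split i) => [{}i|_]; last by exists 1; rewrite contract1.
  case: (split i) => {}i; first by apply: cov; case: hb.
  have /submxP[a] : (row i (row_base (rho_of H)) <= rho_of H)%MS.
    by rewrite -(eq_row_base (rho_of H)) row_sub.
  by rewrite /F' => ->.
- rewrite -[c]hsubmxK -[lsubmx c]hsubmxK !lc_catf lcF' lcH.
  move: (lsubmx (lsubmx c)) (rsubmx (lsubmx c)) (rsubmx c) => c1 c2 c3 eq0.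
  (* Otherwise [H] lies in the span of the $b_j$ and $F_j$, that is in $\int_{\mathfrak m}I^\perp$;
     then $B_H=0$, the $F$-part disappears and [H] is in $I^\perp$. *)
  have c30 : c3 0 0 = 0.
    apply: contrapT => /eqP nz.
    have HE : H = lc b (- (c3 0 0)^-1 *: c1) +
        lc F (- (c3 0 0)^-1 *: (c2 *m row_base (rho_of H))).
      rewrite !linearZ -scalerDr; apply: (scalerI nz); rewrite scalerA mulrN.
      by rewrite mulfV // scaleN1r; apply/eqP; rewrite -addr_eq0 addrC eq0.
    have rho0 : rho_of H = 0 by rewrite rho_of_eq0 // HE; apply: integral_m_lc.
    apply: nH; rewrite HE; have -> : row_base (rho_of H) = 0.
      by apply/eqP; rewrite -mxrank_eq0 eq_row_base rho0 mxrank0.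
    by rewrite mulmx0 scaler0 linear0 addr0; apply: perp_lc.
  have c3E : c3 = 0 by apply/rowP => i; rewrite ord1 c30 mxE.
  move: eq0; rewrite c30 scale0r addr0 => /kbasis_lcF_eq0[-> /eqP].
  rewrite (mulmx_free_eq0 _ (row_base_free _)) => /eqP ->.
  by rewrite c3E !row_mx0.
(* For generation, split [f] into its constant term, its linear part and a remainder of order at
   least 2; they yield [H], the $x_i\circ H$ and an element of $I^\perp$. *)
- pose f' := f - psscale (f 0%MM) 1.
  have f'1 : ord_ge 1 f' by rewrite -frak_mE /frak_m /= eqxx mulr1 subrr.
  have fE : f = f' + psscale (f 0%MM) 1 by rewrite subrK.
  have [g g2 gE] := contract_linear_part H f'1.
  pose a := \row_i f' U_(i)%MM; pose c := coords b (contract g H).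
  have /submxP[d dE] : (a *m rho_of H <= row_base (rho_of H))%MS.
    by rewrite eq_row_base submxMl.
  exists (row_mx (row_mx (a *m mu_of H + c) d) (f 0%MM)%:M).
  rewrite !lc_catf lcF' lcH -dE mxE eqxx mulr1n linearD /= /c.
  rewrite (lc_coords hb); last exact: H2.
  rewrite [in LHS]fE contractDl gE contract_psscale contract1; congr (_ + _).
  rewrite addrAC -(sum_contract_psX a H2).
  by congr (_ + _); apply: eq_bigr => i _; rewrite mxE.
Qed.

Lemma cover_colength H d : in_integral2 H -> ~ perp I H ->
  gorenstein_cover_colength I H d <->
  gorenstein_cover I H /\ (\rank (rho_of H)).+1 = d.
Proof.
move=> H2 nH; split=> [[cov [lG [lA [qG qA lE]]]]|[cov <-]].
  split=> //; have [e he] := cyc_basis H2 nH cov.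
  move: lE; rewrite (quotient_length_uniq qG (quotient_length_Ann he)).
  rewrite (quotient_length_uniq qA (quotient_length_perp idI ordI hb)).
  by rewrite -addnA addn1 => /addnI.
split=> //; have [e he] := cyc_basis H2 nH cov.
exists (t + \rank (rho_of H) + 1)%N, t; split; last by rewrite -addnA addn1.
  exact: quotient_length_Ann he.
exact: quotient_length_perp idI ordI hb.
Qed.

Definition U_of H (v : 'rV[k]_n) : seq 'rV[k]_t :=
  [seq v 0 lk.1 *: row lk.2 (mu_of H) - v 0 lk.2 *: row lk.1 (mu_of H)
     | lk <- enum [pred lk : 'I_n * 'I_n | (lk.1 < lk.2)%N]] ++
  [seq coords b (contract (psmon (bmnm theta)) H)
     | theta <- enum [pred theta : 'X_{1..n < s.+3} | (2 <= mdeg theta)%N]].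

Lemma minor_row H (v : 'rV[k]_n) l i :
  (\rank (row_mx (rho_of H) v^T) < 2)%N ->
  v 0 l *: row i (rho_of H) = v 0 i *: row l (rho_of H).
Proof.
move=> rk; apply/rowP => j.
have := rank_le1_minor l i (rshift h1 0) (lshift 1 j) rk.
rewrite !row_mxEl !row_mxEr [v^T _ _]mxE [v^T _ _]mxE => e.
by rewrite !mxE in e *; rewrite e mulrC.
Qed.

(** An element of $I^\perp$ is $f\circ H$ with $f\in\mathfrak m$. Its linear part sends [H] into
    $I^\perp$, so it is orthogonal to [v] and hence a combination of the $v_lx_i-v_ix_l$; the rest
    is a combination of the $x^\theta$. *)
Lemma U_of_full H (v : 'rV[k]_n) m (U : 'M[k]_(m, t)) : in_integral2 H ->
  ~ perp I H -> gorenstein_cover I H -> rho_of H != 0 -> v != 0 ->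
  (\rank (row_mx (rho_of H) v^T) < 2)%N ->
  (forall r, r \in U_of H v -> (r <= U)%MS) -> row_full U.
Proof.
move=> H2 nH cov rho0 v0 rk subU; rewrite -sub1mx; apply/row_subP => i0.
move: (row i0 _) => c; have [f fE] := cov _ (perp_lc c).
(* If [f] were a unit, [H] would be a contraction of an element of $I^\perp$, hence in $I^\perp$. *)
have f1 : ord_ge 1 f.
  rewrite -frak_mE; apply: contrapT => /eqP f0.
  have [g gE] := contract_unit H f0; apply: nH; rewrite -gE contractM -fE.
  exact/perp_contract/perp_lc.
have [g g2 gE] := contract_linear_part H f1.
pose a := \row_i f U_(i)%MM.
(* Two variables bring [H] into $I^\perp$, which is killed by $\mathfrak m^{s+1}\subset I$; hence
   exponents of degree at most $s+2$ suffice. *)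
have kill h : ord_ge s.+3 h -> contract h H = 0.
  move=> /ord_ge_psX[g1 g1s ->]; rewrite contract_suml big1 // => i _.
  have /ord_ge_psX[g2' g2s ->] := g1s i.
  rewrite mulr_sumr contract_suml big1 // => j _.
  rewrite mulrA mulrC contractM.
  have H11 : perp I (contract (psX i * psX j) H).
    apply: H2; rewrite -[2%N]/(1 + 1)%N; apply: ord_geM.
      by rewrite -frak_mE /frak_m /= eq_sym mnm1_eq0.
    by rewrite -frak_mE /frak_m /= eq_sym mnm1_eq0.
  exact/H11/ordI.
pose c' := \sum_(th : 'X_{1..n < s.+3}) g th *: coords b (contract (psmon th) H).
have gE' : contract g H = lc b c'.
  rewrite (contract_monomials g kill) /c' linear_sum; apply: eq_bigr => th _.
  rewrite linearZ /=; have [lt2|le2] := ltnP (mdeg th) 2.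
    by rewrite g2 // !scale0r.
  rewrite (lc_coords hb) //; apply: H2 => m' lt_m /=.
  by case: eqP => // m_th; move: lt_m; rewrite m_th ltnNge le2.
(* Comparing coordinates: the $b$-part determines [c], and the $F$-part says that [a] annihilates
   $B_H$. *)
have /kbasis_lcF_eq0[cE aE] :
    lc b (c - (a *m mu_of H + c')) + lc F (- (a *m rho_of H)) = 0.
  have sumE : \sum_i f U_(i)%MM *: contract (psX i) H =
      lc b (a *m mu_of H) + lc F (a *m rho_of H).
    by rewrite -sum_contract_psX //; apply: eq_bigr => i _; rewrite mxE.
  rewrite linearB /= fE gE gE' linearD linearN /= sumE.
  by rewrite -addrA -opprD [X in _ - X]addrAC subrr.
have -> : c = a *m mu_of H + c' by apply/eqP; rewrite -subr_eq0 cE.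
apply: addmx_sub; last first.
  apply: summx_sub => th _; have [lt2|le2] := ltnP (mdeg th) 2.
    by rewrite g2 // scale0r sub0mx.
  apply/scalemx_sub/subU; rewrite mem_cat; apply/orP; right.
  by apply/mapP; exists th => //; rewrite mem_enum inE.
have /matrix0Pn[z [l]] := v0; rewrite (ord1 z) => vl {z}.
have cross i j : (v 0 j *: row i (mu_of H) - v 0 i *: row j (mu_of H) <= U)%MS.
  have [lt_ij|lt_ji|/val_inj ->] := ltngtP i j; last by rewrite subrr sub0mx.
  - rewrite -opprB eqmx_opp; apply: subU; rewrite mem_cat; apply/orP; left.
    by apply/mapP; exists (i, j) => //; rewrite mem_enum inE.
  - apply: subU; rewrite mem_cat; apply/orP; left.
    by apply/mapP; exists (j, i) => //; rewrite mem_enum inE.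
have rho_l : row l (rho_of H) != 0.
  apply: contra rho0 => /eqP l0; apply/eqP/row_matrixP => i; rewrite row0.
  by apply: (scalerI vl); rewrite (minor_row l i rk) l0 !scaler0.
(* Row $i$ of $B_H$ is $v_i/v_l$ times its nonzero row $l$, so $aB_H=0$ means $\sum_i a_iv_i=0$. *)
have av : \sum_i a 0 i * v 0 i = 0.
  have arho : a *m rho_of H = 0 by apply/eqP; rewrite -oppr_eq0 aE.
  have : (\sum_i a 0 i * v 0 i) *: row l (rho_of H) == 0.
    rewrite scaler_suml -[eqbRHS](scaler0 _ (v 0 l)) -[X in _ *: X]arho.
    rewrite mulmx_sum_row scaler_sumr.
    apply/eqP; apply: eq_bigr => i _.
    by rewrite -scalerA -(minor_row l i rk) !scalerA mulrC.
  by rewrite scaler_eq0 (negPf rho_l) orbF => /eqP.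
(* The subtracted terms add up to a multiple of $\sum_i a_iv_i=0$. *)
have -> : a *m mu_of H = \sum_i (a 0 i / v 0 l) *:
    (v 0 l *: row i (mu_of H) - v 0 i *: row l (mu_of H)).
  under eq_bigr do rewrite scalerBr !scalerA divfK // mulrAC.
  by rewrite sumrB -mulmx_sum_row -scaler_suml -mulr_suml av mul0r scale0r subr0.
by apply: summx_sub => i _; apply: scalemx_sub.
Qed.

(** Each row of [U] is the coordinate vector of an element of $\langle H\rangle$, so full rank puts
    all of $I^\perp$ in $\langle H\rangle$. *)
Lemma cover_of_U_full H (v : 'rV[k]_n) m (U : 'M[k]_(m, t)) : in_integral2 H ->
  (\rank (row_mx (rho_of H) v^T) < 2)%N -> (forall i, row i U \in U_of H v) ->
  row_full U -> gorenstein_cover I H.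
Proof.
move=> H2 rk Urows /submx_full fullU G' /(lc_coords hb) <-.
have /submxP[d ->] := fullU _ (coords b G').
rewrite mulmx_sum_row linear_sum; apply: (big_ind (cyc H)) => [||i _].
- exact: cyc0.
- exact: cycD.
rewrite linearZ /=; apply: cycZ; move: (Urows i); rewrite mem_cat.
case/orP=> /mapP[]; last first.
  move=> th; rewrite mem_enum inE => th2 ->; rewrite (lc_coords hb).
    exact: cyc_contract.
  apply: H2 => m' lt_m /=.
  by case: eqP => // m_th; move: lt_m; rewrite m_th ltnNge th2.
move=> [j l] _ -> /=.
have -> : lc b (v 0 j *: row l (mu_of H) - v 0 l *: row j (mu_of H)) =
    v 0 j *: contract (psX l) H - v 0 l *: contract (psX j) H.
  (* The $2\times2$ minors of $C_{H,v}$ make the $F$-parts cancel, leaving only the $b$-parts. *)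
  have e : v 0 j *: lc F (row l (rho_of H)) = v 0 l *: lc F (row j (rho_of H)).
    by have := congr1 (lc F) (minor_row j l rk); rewrite !(linearZ_LR (lc F)).
  rewrite !contract_psX // !scalerDr e opprD addrACA subrr addr0.
  by rewrite linearB /= !(linearZ_LR (lc b)).
rewrite -scaleNr; apply: cycD; exact/cycZ/cyc_contract.
Qed.

End Cover.

(** * Evaluation of the generic matrices *)

Section Homogeneous.
Context {k : fieldType}.

Lemma homog_coords_ex m (P : proj k m) : exists u, homog_coords P u.
Proof.
exists (vpick (val P)); split; last exact: memv_pick.
rewrite vpick0 -dimv_eq0; case: P => L /= /eqP ->; by [].
Qed.

Lemma homog_coords_scale m (P : proj k m) u u' :
  homog_coords P u -> homog_coords P u' -> exists2 c, c != 0 & u' = c *: u.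
Proof.
case: P => L /= /eqP dL [/= u0 uL] [/= u'0 u'L].
have eL : <[u]>%VS = L.
  by apply/eqP; rewrite eqEdim -memvE uL dL dim_vline u0.
move: u'L; rewrite -eL => /vlineP[c u'E]; exists c => //.
by apply: contra u'0 => /eqP c0; rewrite u'E c0 scale0r.
Qed.

Lemma proj_of_vector m (u : 'rV[k]_m) : u != 0 ->
  exists P : proj k m, homog_coords P u.
Proof.
move=> u0; have dL : \dim <[u]>%VS == 1%N by rewrite dim_vline u0.
by exists (exist (fun L => \dim L == 1%N) _ dL); split; rewrite //= memv_line.
Qed.

Lemma ideal_gen_vanish N (X : set {mpoly k[N]}) (p : 'I_N -> k) :
  (forall f, ideal_gen X f -> f.@[p] = 0) <-> (forall f, X f -> f.@[p] = 0).
Proof.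
split=> [X0 f Xf|X0 f Xf]; first by apply: X0 => J [_ XJ]; apply: XJ.
apply: (Xf [set f | f.@[p] = 0]); split=> //.
split=> [|x y x0 y0|a x x0]; first exact: meval0.
  by rewrite /= mevalD x0 y0 addr0.
by rewrite /= mevalM x0 mulr0.
Qed.

(** Evaluation commutes with determinants, and the polynomials vanishing at a point form an ideal;
    so vanishing becomes a rank condition at that point. *)
Lemma ideal_minors_vanish N (p : 'I_N -> k) m q r (M : 'M[{mpoly k[N]}]_(m, q)) :
  (forall f, ideal_gen (minors r M) f -> f.@[p] = 0) <->
  (\rank (map_mx (meval p) M) < r)%N.
Proof.
rewrite ideal_gen_vanish -minors_rank; split=> M0.
  move=> _ [f [g [fi gi ->]]]; rewrite -map_mxsub det_map_mx /=.
  by apply: M0; exists f, g.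
move=> _ [f [g [fi gi ->]]]; rewrite -det_map_mx map_mxsub.
by apply: M0; exists f, g.
Qed.

End Homogeneous.

Section Evaluation.
Context {k : fieldType} {n : nat}.
Local Notation R := (mpseries n k).
Local Notation S := {mpoly k[n]}.
Variables (I : set R) (s t h1 h2 : nat).
Variables (b : 'I_t -> S) (F : 'I_h1 -> S) (G : 'I_h2 -> S).
Hypothesis hb : is_kbasis b (perp I).
Hypothesis hF : is_kbasis (catf b F) (integral (@frak_m n k) (perp I)).
Hypothesis hG : is_kbasis (catf (catf b F) G)
  (integral (ideal_exp (@frak_m n k) 2) (perp I)).
Variables (N : nat) (w : 'I_(h1 + h2) -> {mpoly k[N]}) (x : 'I_n -> {mpoly k[N]}).
Variables (p : 'I_N -> k) (u : 'rV[k]_(h1 + h2)) (v : 'rV[k]_n).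
Hypothesis wp : forall i, (w i).@[p] = u 0 i.
Hypothesis xp : forall i, (x i).@[p] = v 0 i.

Local Notation H := (Hof F G u).

(** Contraction is linear in [H]. The membership conditions keep [coords] away from its default
    value 0. With [w] and [p] abstract, the lemma serves both $\mathbf k[\alpha,\beta]$ and $\mathbf
    k[\alpha,\beta,v]$. *)
Lemma generic_coords_eval m (X : 'I_m -> S) M f :
  is_kbasis X M -> (forall i, M (contract f (catf F G i))) ->
  M (contract f H) ->
  map_mx (meval p) (generic_coords F G w X f) = coords X (contract f H).
Proof.
move=> bX Mi MH; apply/esym/(coords_eq bX) => //.
rewrite /Hof (linear_sum (contract f)).
transitivity (lc X (\sum_i u 0 i *: coords X (contract f (catf F G i)))).
  rewrite linear_sum; apply: eq_bigr => i _.
  by rewrite /= contractZ (linearZ_LR (lc X)) /= (lc_coords bX).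
congr (lc X _); apply/rowP => j; rewrite summxE !mxE raddf_sum.
by apply: eq_bigr => i _; rewrite /= mevalZ wp mxE mulrC.
Qed.

Lemma generic_coords_psX i :
  map_mx (meval p) (generic_coords F G w (catf b F) (psX i)) =
  coords (catf b F) (contract (psX i) H).
Proof.
apply: (generic_coords_eval hF) => [j|].
  exact/integral_m_contract/(in_integral2_FG hG).
exact/integral_m_contract/(in_integral2_Hof hG).
Qed.

Lemma mu_mx_eval : map_mx (meval p) (mu_mx b F G w) = mu_of b F H.
Proof.
apply/row_matrixP => i; rewrite rowK -generic_coords_psX.
by rewrite -map_row rowK map_lsubmx.
Qed.

Lemma B_mx_eval : map_mx (meval p) (B_mx b F G w) = rho_of b F H.
Proof.
apply/row_matrixP => i; rewrite rowK -generic_coords_psX.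
by rewrite -map_row rowK map_rsubmx.
Qed.

Lemma C_mx_eval :
  map_mx (meval p) (C_mx b F G w x) = row_mx (rho_of b F H) v^T.
Proof.
rewrite map_row_mx B_mx_eval; congr row_mx.
by apply/matrixP => i j; rewrite !mxE xp ord1.
Qed.

Lemma U_rows_eval :
  [seq map_mx (meval p) r | r <- U_rows s b F G w x] = U_of s b F H v.
Proof.
rewrite map_cat -!map_comp; congr (_ ++ _).
  apply: eq_map => -[l i] /=; rewrite -mu_mx_eval.
  by apply/rowP => j; rewrite !mxE mevalB !mevalM !xp.
apply/eq_in_map => th; rewrite mem_enum inE => le2 /=.
have g2 : ord_ge 2 (psmon (bmnm th) : R).
  by move=> m lt_m /=; case: eqP => // e; move: lt_m; rewrite e ltnNge le2.
apply: (generic_coords_eval hb) => [i|]; first exact: (in_integral2_FG hG).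
exact: (in_integral2_Hof hG).
Qed.

Let U := map_mx (meval p) (U_mx s b F G w x).

Let row_U i : row i U = nth 0 (U_of s b F H v) i.
Proof.
rewrite -U_rows_eval (nth_map 0) // -map_row.
by congr map_mx; apply/rowP => j; rewrite !mxE.
Qed.

Lemma U_mx_row i : row i U \in U_of s b F H v.
Proof. by rewrite row_U mem_nth // -U_rows_eval size_map. Qed.

Lemma U_mx_sub r : r \in U_of s b F H v -> (r <= U)%MS.
Proof.
rewrite -U_rows_eval => /mapP[r0 r0U ->].
have lt_i : (index r0 (U_rows s b F G w x) < size (U_rows s b F G w x))%N.
  by rewrite index_mem.
have := row_sub (Ordinal lt_i) U; rewrite row_U -U_rows_eval.
by rewrite (nth_map 0) // nth_index.
Qed.

End Evaluation.

(** * Existence of the point $[v]$, and change of representatives *)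

Lemma rank_le1_extend (k : fieldType) n h (M : 'M[k]_(n, h)) : (0 < n)%N ->
  (\rank M < 2)%N ->
  exists2 v : 'rV[k]_n, v != 0 & (\rank (row_mx M v^T) < 2)%N.
Proof.
move=> n0 rk; have [->|/matrix0Pn[i [j nz]]] := eqVneq M 0.
  exists (const_mx 1).
    by apply/matrix0Pn; exists 0, (Ordinal n0); rewrite mxE oner_neq0.
  set w := (const_mx 1)^T.
  have -> : row_mx 0 w = w *m row_mx (0 : 'M_(1, h)) 1%:M.
    by rewrite mul_mx_row mulmx0 mulmx1.
  by rewrite ltnS (leq_trans (mxrankM_maxl _ _)) ?rank_leq_col.
(* A nonzero column may be repeated without raising the rank; for the zero matrix any nonzero [v]
   served. *)
exists (col j M)^T; first by apply/matrix0Pn; exists 0, i; rewrite !mxE.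
rewrite trmxK colE -[X in row_mx X _]mulmx1 -mul_mx_row.
exact: leq_ltn_trans (mxrankM_maxl _ _) rk.
Qed.

(** Ensures that $\mathbb P^{n-1}$ has a point. For $n=0$ the ring is a field: either $I=0$ and
    $I^\perp$ is everything, or $I=R$ and there is no socle degree. *)
Lemma notin_perp_vars_gt0 n (k : fieldType) (I : set (mpseries n k)) s H :
  is_ideal I -> socle_degree I s -> ~ perp I H -> (0 < n)%N.
Proof.
move=> idI [nI _] nH; case: (posnP n) => // n0; case: nI => g _; subst n.
have [f If f0] : exists2 f, I f & f 0%MM != 0.
  apply: contrapT => I0; apply: nH => f If; have -> : f = 0.
    apply: mpseriesP => m; rewrite nvar0_mnmE; apply: contrapT => /eqP f0.
    by apply: I0; exists f.
  exact: contract0l.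
have -> : g = psscale (f 0%MM)^-1 (g * f).
  have {2}-> : f = psscale (f 0%MM) 1.
    by apply: mpseriesP => m; rewrite nvar0_mnmE /= eqxx mulr1.
  by rewrite mulrC -psscaleE; apply: mpseriesP => m; rewrite /= mulKf.
by apply: ideal_psscale => //; case: idI => _ _; apply.
Qed.

Section Scaling.
Context {k : fieldType} {n : nat}.
Local Notation R := (mpseries n k).
Local Notation S := {mpoly k[n]}.
Variables (I : set R) (t h1 : nat) (b : 'I_t -> S) (F : 'I_h1 -> S).
Hypothesis hF : is_kbasis (catf b F) (integral (@frak_m n k) (perp I)).

Lemma rho_ofZ c H : in_integral2 I H -> rho_of b F (c *: H) = c *: rho_of b F H.
Proof.
move=> H2; apply/matrixP => i j; have mH := integral_m_contract i H2.
have e : coords (catf b F) (contract (psX i) (c *: H)) =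
    c *: coords (catf b F) (contract (psX i) H).
  apply: (coords_eq hF); rewrite contractZ.
    by rewrite (linearZ_LR (lc _)) /= (lc_coords hF).
  by move=> f mf; rewrite contractZ; apply/perpZ/mH.
by rewrite !mxE e !mxE.
Qed.

End Scaling.

Theorem corollary5p21 (k : closedFieldType) (n : nat) (I : set (mpseries n k))
    (hI : is_ideal I) (hloc : local_quotient I) (hart : artinian_quotient I)
    (hgcl : exists2 d : nat, gcl I d & (1 < d)%N)
    (s : nat) (hs : socle_degree I s)
    (t h1 h2 : nat) (b : 'I_t -> {mpoly k[n]})
    (F : 'I_h1 -> {mpoly k[n]}) (G : 'I_h2 -> {mpoly k[n]})
    (hb : is_kbasis b (perp I))
    (hF : is_kbasis (catf b F) (integral (@frak_m n k) (perp I)))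
    (hG : is_kbasis (catf (catf b F) G)
                    (integral (ideal_exp (@frak_m n k) 2) (perp I))) :
  MGC2 I F G =
  Vplus (frak_b b F G) `\`
    [set PQ.1 | PQ in Vplus2 (frak_c b F G) `&` Vplus2 (frak_a s b F G)].
Proof.
have H2 u := in_integral2_Hof hG u.
have nH u := @Hof_notin_perp _ _ _ _ _ _ _ _ _ hb hG u.
have wl (u : 'rV[k]_(h1 + h2)) (v : 'rV[k]_n) i :
    ('X_(lshift n i) : {mpoly k[_]}).@[fun i => row_mx u v 0 i] = u 0 i.
  by rewrite mevalXU row_mxEl.
have wr (u : 'rV[k]_(h1 + h2)) (v : 'rV[k]_n) i :
    ('X_(rshift (h1 + h2) i) : {mpoly k[_]}).@[fun i => row_mx u v 0 i] = v 0 i.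
  by rewrite mevalXU row_mxEr.
have bE (u : 'rV_(h1 + h2)) :
    (forall f, frak_b b F G f -> f.@[fun i => u 0 i] = 0) <->
    (\rank (rho_of b F (Hof F G u)) < 2)%N.
  by rewrite /frak_b ideal_minors_vanish (B_mx_eval hF hG (u := u)) // => i;
     rewrite mevalXU.
have cE (u : 'rV_(h1 + h2)) (v : 'rV_n) :
    (forall f, frak_c b F G f -> f.@[fun i => row_mx u v 0 i] = 0) <->
    (\rank (row_mx (rho_of b F (Hof F G u)) v^T) < 2)%N.
  by rewrite /frak_c ideal_minors_vanish (C_mx_eval hF hG (wl u v) (wr u v)).
apply/seteqP; split=> P.
  case=> u Pu /(cover_colength hI hs hb hF 2 (H2 u) (nH _ Pu.1))[cov [rk1]].
  split=> [u' Pu'|[[P' Q] [cPQ aPQ] /= eP]].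
    apply/bE; have [c c0 ->] := homog_coords_scale Pu Pu'.
    rewrite Hof_lc (linearZ_LR (lc (catf F G))) (rho_ofZ hF _ (H2 u)).
    by rewrite mxrank_scale_nz -?Hof_lc ?rk1.
  subst P'; have [v Qv] := homog_coords_ex Q.
  (* A point of $\mathbb V_+(\mathfrak a)$ over $[H]$ would make the rank of $U_{H,v}$ less than
     $t$, whereas the cover condition forces its rows to span. *)
  have /ideal_minors_vanish := aPQ _ _ Pu Qv; rewrite ltnNge => /negP[].
  have /cE rkC := cPQ _ _ Pu Qv.
  apply/eq_leq/esym/eqP.
  apply: (U_of_full hs hb hF (H2 u) (nH _ Pu.1) cov _ Qv.1 rkC) => [|r].
    by rewrite -mxrank_eq0 rk1.
  exact: (U_mx_sub hb hF hG (wl u v) (wr u v)).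
case=> Pb nPi; have [u Pu] := homog_coords_ex P.
have n0 := notin_perp_vars_gt0 hI hs (nH _ Pu.1).
have /bE rk := Pb _ Pu.
have [v v0 rkC] := rank_le1_extend n0 rk.
have [Q Qv] := proj_of_vector v0.
(* $\mathbb V_+(\mathfrak c)$ quantifies over all representatives; rescaling them multiplies
   $C_{H,v}$ on the right by a block diagonal matrix, which cannot raise the rank. *)
have cPQ : Vplus2 (frak_c b F G) (P, Q).
  move=> u' v' Pu' Qv'; apply/cE.
  have [c c0 ->] := homog_coords_scale Pu Pu'.
  have [d d0 ->] := homog_coords_scale Qv Qv'.
  rewrite Hof_lc (linearZ_LR (lc (catf F G))) (rho_ofZ hF _ (H2 u)) linearZ /=.
  suff -> : row_mx (c *: rho_of b F (Hof F G u)) (d *: v^T) =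
      row_mx (rho_of b F (Hof F G u)) v^T *m block_mx c%:M 0 0 d%:M.
    exact: leq_ltn_trans (mxrankM_maxl _ _) rkC.
  by rewrite mul_row_block !mulmx0 addr0 add0r !mul_mx_scalar.
have : ~ Vplus2 (frak_a s b F G) (P, Q).
  by move=> aPQ; apply: nPi; exists (P, Q).
(* Failing to lie in $\mathbb V_+(\mathfrak a)$ yields some representatives with a nonzero value;
   from here on they replace [u] and [v]. *)
move=> /existsNP[u' /existsNP[v' /not_implyP[Pu' /not_implyP[Qv' nvan]]]].
have rkU : ~ (\rank (map_mx (meval (fun i => row_mx u' v' 0%R i))
    (U_mx s b F G (fun i => 'X_(lshift n i)) (fun l => 'X_(rshift (h1 + h2) l))))
    < t)%N.
  by move/ideal_minors_vanish/nvan.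
have /cE rkC' := cPQ _ _ Pu' Qv'.
have cov : gorenstein_cover I (Hof F G u').
  apply: (cover_of_U_full hb hF (H2 u') rkC').
    exact: (U_mx_row hb hF hG (wl u' v') (wr u' v')).
  rewrite /row_full eqn_leq rank_leq_col leqNgt; apply/negP; exact: rkU.
have covP d := cover_colength hI hs hb hF d (H2 u') (nH _ Pu'.1).
exists u' => //; apply/covP; split=> //; congr S.
have /bE rk' := Pb _ Pu'.
apply/eqP; rewrite eqn_leq -ltnS rk' /=.
(* The colength of this cover is $\mathrm{rk}\,B_H+1$, so $\mathrm{gcl}(A)>1$ excludes $B_H=0$. *)
have [d [_ min_d] d1] := hgcl.
have /min_d : gorenstein_cover_colength I (Hof F G u')
    (\rank (rho_of b F (Hof F G u'))).+1.
  exact/covP.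
by move/(leq_trans d1).
Qed.
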